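(* Let $d,m\ge0$, $1\le k\le\ell$ and $0\le p\le\ell$ be integers. Let $\mathcal{A}^{p,k}_\ell(m,d)$ be the arrangement in $\mathbb{R}^\ell$ consisting of the hyperplanes: $x_i-x_j=0$ for $1\le i<j\le\ell$; $x_i-x_j=1$ for $1\le i<j\le\ell+1-k$; $x_i=s$ for $1\le i\le p$ and integers $1-\min\{\ell-i+1,k\}-m\le s\le d$; and $x_i=s$ for $p<i\le\ell$ and integers $-\min\{\ell-i+1,k\}-m\le s\le d$. Then the cone $\mathbf{c}\mathcal{A}^{p,k}_\ell(m,d)$ is ind-flag-accurate with exponents $1$, $(\ell+m+d)$ with multiplicity $p$, and $(\ell+m+d+1)$ with multiplicity $\ell-p$.
   Context: For an affine arrangement $\mathcal{A}$ in $\mathbb{R}^\ell$, its cone $\mathbf{c}\mathcal{A}$ is the central arrangement in $V'=\mathbb{R}^{\ell+1}$ (extra coordinate $z$) consisting of the hyperplanes $a_1x_1+\dots+a_\ell x_\ell=dz$ for each hyperplane $a_1x_1+\dots+a_\ell x_\ell=d$ of $\mathcal{A}$, together with $z=0$. For a central arrangement $\mathcal{A}$ in $W=\mathbb{R}^N$: $L(\mathcal{A})$ is the set of intersections of subsets of $\mathcal{A}$ (including $W$); $\mathcal{A}^X=\{H\cap X:H\in\mathcal{A},X\not\subseteq H\}$; $\mathcal{A}$ is free if $D(\mathcal{A})=\{\theta\in\mathrm{Der}(S):\theta(\alpha_H)\in\alpha_HS\ \forall H\}$ is free over $S=\mathbb{R}[x_1,\dots,x_N]$, exponents being degrees of a homogeneous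 basis. Inductively free arrangements: smallest class containing empty arrangements and containing $\mathcal{A}$ whenever some $H\in\mathcal{A}$ has $\mathcal{A}\setminus\{H\}$ and $\mathcal{A}^H$ in the class with $\exp(\mathcal{A}^H)\subseteq\exp(\mathcal{A}\setminus\{H\})$. $\mathcal{A}$, free with exponents $e_1\le\dots\le e_N$, is ind-flag-accurate if it is inductively free and there is a flag $X_1\subseteq\dots\subseteq X_N=W$ in $L(\mathcal{A})$ with $\dim X_d=d$ and each $\mathcal{A}^{X_d}$ inductively free with exponents $(e_1,\dots,e_d)$. *)

(* Defs.v *)
From HB Require Import structures.
From mathcomp Require Import all_boot all_order all_algebra.
From mathcomp Require Import finmap mpoly.
From mathcomp Require Export -(notations) reals.

Set Implicit Arguments.
Unset Strict Implicit.
Unset Printing Implicit Defensive.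

Import Order.TTheory GRing.Theory Num.Theory.
Local Open Scope ring_scope.

(** A central arrangement is given by its ambient space, a subspace [W] of a
    fixed space [V], and by a finite set of hyperplanes of [W].  Restricting to
    [X] thus changes the ambient space from [W] to [X] but stays inside [V]. *)

Definition is_arrangement (R : realType) (V : vectType R)
    (W : {vspace V}) (A : {fset {vspace V}}) : Prop :=
  forall H, H \in A -> (H <= W)%VS /\ (\dim H).+1 = \dim W.

Definition in_lattice (R : realType) (V : vectType R)
    (W : {vspace V}) (A : {fset {vspace V}}) (X : {vspace V}) : Prop :=
  exists2 B : {fset {vspace V}},
    (B `<=` A)%fset & X = (W :&: \bigcap_(H <- B) H)%VS.

Definition restr (R : realType) (V : vectType R)
    (A : {fset {vspace V}}) (X : {vspace V}) : {fset {vspace V}} :=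
  [fset (H :&: X)%VS | H in A & ~~ (X <= H)%VS]%fset.

(** The coordinate ring of [W] is [{mpoly R[\dim W]}], its variables being the
    coordinates with respect to [vbasis W]; [form_poly W f] is the restriction
    to [W] of the linear form [f], written in these coordinates. *)

Definition form_poly (R : realType) (V : vectType R) (W : {vspace V})
    (f : 'Hom(V, R^o)) : {mpoly R[\dim W]} :=
  \sum_(i < \dim W) (f (tnth (vbasis W) i) : R) *: 'X_i.

Definition is_derivation (R : realType) (n : nat)
    (D : {mpoly R[n]} -> {mpoly R[n]}) : Prop :=
  linear D /\ forall q r, D (q * r) = D q * r + q * D r.

(** Membership in D(A).  Any two forms [f] defining [H] in [W] are proportional
    on [W], so quantifying over all of them amounts to fixing one. *)
Definition log_derivation (R : realType) (V : vectType R)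
    (W : {vspace V}) (A : {fset {vspace V}})
    (D : {mpoly R[\dim W]} -> {mpoly R[\dim W]}) : Prop :=
  is_derivation D /\
  forall H, H \in A ->
  forall f : 'Hom(V, R^o), H = (lker f :&: W)%VS ->
  exists g : {mpoly R[\dim W]}, D (form_poly W f) = g * form_poly W f.

Arguments log_derivation {R V} W A D.

Definition log_basis (R : realType) (V : vectType R)
    (W : {vspace V}) (A : {fset {vspace V}}) (r : nat)
    (D : 'I_r -> {mpoly R[\dim W]} -> {mpoly R[\dim W]}) : Prop :=
  [/\ forall i, log_derivation W A (D i),
      forall E, log_derivation W A E ->
        exists g : 'I_r -> {mpoly R[\dim W]},
          forall q, E q = \sum_(i < r) g i * D i q
    & forall g : 'I_r -> {mpoly R[\dim W]},
        (forall q, \sum_(i < r) g i * D i q = 0) -> forall i, g i = 0].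

Arguments log_basis {R V} W A {r} D.

(** [A] is free with multiset of exponents [e]; the order of [e] is immaterial.
    The degree of a homogeneous derivation is the polynomial degree of its
    coefficients, so that the Euler derivation has degree 1. *)
Definition has_exponents (R : realType) (V : vectType R)
    (W : {vspace V}) (A : {fset {vspace V}}) (e : seq nat) : Prop :=
  exists2 D : 'I_(size e) -> {mpoly R[\dim W]} -> {mpoly R[\dim W]},
    log_basis W A D
  & forall i j, D i 'X_j \is (nth 0%N e i).-homog.

Inductive ind_free (R : realType) (V : vectType R) :
    {vspace V} -> {fset {vspace V}} -> Prop :=
| ind_free_empty (W : {vspace V}) : ind_free W fset0
| ind_free_add (W : {vspace V}) (A : {fset {vspace V}}) (H : {vspace V})
    (e1 e2 : seq nat) of
    is_arrangement W A & H \in A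
  & ind_free W (A `\ H)%fset & ind_free H (restr A H)
  & has_exponents W (A `\ H)%fset e1 & has_exponents H (restr A H) e2
  & (forall x, (count_mem x e2 <= count_mem x e1)%N) :
    ind_free W A.

(** The members [X 1, ..., X (\dim W)] of [X] are the flag. *)
Definition ind_flag_accurate (R : realType) (V : vectType R)
    (W : {vspace V}) (A : {fset {vspace V}}) : Prop :=
  exists e : seq nat,
  [/\ is_arrangement W A, sorted leq e, has_exponents W A e, ind_free W A
    & exists X : nat -> {vspace V},
      [/\ X (\dim W) = W,
          forall i, (1 <= i < \dim W)%N -> (X i <= X i.+1)%VS
        & forall i, (1 <= i <= \dim W)%N ->
          [/\ in_lattice W A (X i), \dim (X i) = i,
              ind_free (X i) (restr A (X i))
            & has_exponents (X i) (restr A (X i)) (take i e)]]].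

(** An affine arrangement in R^l is a list of equations: [(a, c)] stands for the
    affine hyperplane [x *m a = c]. *)

Definition lin_hyp (R : realType) (n : nat) (u : 'cV[R]_n) : {vspace 'rV[R]_n} :=
  lker (linfun (mulmxr u : 'rV[R]_n -> 'rV[R]_1)).

Lemma mem_lin_hyp (R : realType) (n : nat) (u : 'cV[R]_n) (v : 'rV[R]_n) :
  (v \in lin_hyp u) = (v *m u == 0).
Proof. by rewrite memv_ker lfunE. Qed.

(** The coordinates of R^(l + 1) are x_1, ..., x_l followed by z. *)
Definition cone (R : realType) (l : nat) (A : seq ('cV[R]_l * R)) :
    {fset {vspace 'rV[R]_(l + 1)}} :=
  ([fset lin_hyp (col_mx h.1 (- h.2)%:M) | h in A] `|`
   [fset lin_hyp (col_mx 0 1%:M)])%fset.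

Lemma mem_cone_hyp (R : realType) (l : nat) (a : 'cV[R]_l) (c : R)
    (x : 'rV[R]_l) (z : 'rV[R]_1) :
  (row_mx x z \in lin_hyp (col_mx a (- c)%:M)) = (x *m a == c *: z).
Proof. by rewrite mem_lin_hyp mul_row_col mul_mx_scalar scaleNr subr_eq0. Qed.

Definition zrange (a b : int) : seq int :=
  if a <= b then [seq a + n%:Z | n <- iota 0 `|b - a|%N.+1] else [::].

Lemma mem_zrange (a b s : int) : (s \in zrange a b) = (a <= s <= b).
Proof.
rewrite /zrange; case: (lerP a b) => hab; last first.
  rewrite in_nil; apply/esym/negP => /andP[h1 h2].
  by have := lt_le_trans hab (le_trans h1 h2); rewrite ltxx.
apply/mapP/andP => [[n]|[h1 h2]].
  rewrite mem_iota add0n ltnS /= -lez_nat gez0_abs ?subr_ge0 // => hn ->.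
  by rewrite lerDl lez_nat leq0n addrC -lerBrDr.
exists `|s - a|%N; last by rewrite gez0_abs ?subr_ge0 // [RHS]addrC subrK.
by rewrite mem_iota add0n ltnS /= -lez_nat !gez0_abs ?subr_ge0 // lerD2r.
Qed.

(** Ordinals count from 0: the coordinate x_i is that of the ordinal [i - 1]. *)
Definition coord_form (R : realType) (l : nat) (i : 'I_l) : 'cV[R]_l :=
  delta_mx i 0.

Definition arr_Apk (R : realType) (l m d p k : nat) : seq ('cV[R]_l * R) :=
  [seq (coord_form R i - coord_form R j, 0)
     | i <- enum 'I_l, j <- [seq j : 'I_l <- enum 'I_l | (i < j)%N]]
  ++ [seq (coord_form R i - coord_form R j, 1)
     | i <- enum 'I_l,
       j <- [seq j : 'I_l <- enum 'I_l | (i < j)%N && (j.+1 <= l + 1 - k)%N]]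
  ++ [seq (coord_form R i, s%:~R)
     | i <- [seq i : 'I_l <- enum 'I_l | (i.+1 <= p)%N],
       s <- zrange (1 - (minn (l - i.+1 + 1) k)%:Z - m%:Z) d%:Z]
  ++ [seq (coord_form R i, s%:~R)
     | i <- [seq i : 'I_l <- enum 'I_l | (p < i.+1)%N],
       s <- zrange (- (minn (l - i.+1 + 1) k)%:Z - m%:Z) d%:Z].

(* Main.v *)
(* Terao's addition theorem makes the whole argument combinatorial.  It is
   proved as follows.  Let H = ker alpha be the added hyperplane, D a logarithmic
   derivation of the arrangement A without H, and X a hyperplane of H through
   which exactly r members of A pass.  For a member K of A through X the
   polynomial alpha D(alpha_K) - alpha_K D(alpha) is divisible by all the r
   forms, so the restriction of D(alpha) to H is divisible by alpha_X^(r-1), and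
   hence by a polynomial B of degree |A| - |A^H|.  A basis element of that degree
   which does not lie in D(A + H) clears the others; it exists, since otherwise
   too many basis elements would restrict to the span of too few in D(A^H).

   The cone of A^{p,k}_l(m,d) is built from Shi-type arrangements on the first
   q = l + 1 - k coordinates, which are independent of the others: the values of
   x_i for i > q are nested, so adding such a coordinate is a fibration all of
   whose restrictions are the arrangement below.  For the Shi part, one removes
   x_p = a, where a is the least value; the restriction is again of Shi type with
   one coordinate less, one value more, and the same parameter p.  When no values
   are left, the differences x_i - x_q give a Shi arrangement on q - 1
   coordinates.  For the flag, restrict successively to the largest value of the
   last coordinate. *)
From HB Require Import structures.
Require Import Defs.
From mathcomp Require Import all_boot all_order all_algebra all_fingroup.
From mathcomp Require Import finmap mpoly ring lra zify.

Set Implicit Arguments.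
Unset Strict Implicit.
Unset Printing Implicit Defensive.

Import Order.TTheory GRing.Theory Num.Theory.
Local Open Scope ring_scope.

(** * Divisibility, linear dependence and homogeneous components *)

Lemma mpoly_ring_ind (R : comNzRingType) (n : nat) (P : {mpoly R[n]} -> Prop) :
  (forall c, P c%:MP) -> (forall i, P 'X_i) ->
  (forall p q, P p -> P q -> P (p + q)) ->
  (forall p q, P p -> P q -> P (p * q)) ->
  forall p, P p.
Proof.
move=> PC PX PD PM p; rewrite [p]mpolyE.
elim/big_rec: _ => [|m q _ Pq]; first by rewrite -mpolyC0.
apply: (PD) => //; rewrite -mul_mpolyC; apply: (PM) => //.
rewrite mpolyXE_id; elim/big_rec: _ => [|i r _ Pr]; first by rewrite -mpolyC1.
by apply: (PM) => //; elim: (m i) => [|k ih]; rewrite ?expr0 -?mpolyC1 // exprS; apply: (PM).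
Qed.

Definition pdvd (S : comNzRingType) (a q : S) : Prop := exists g, q = g * a.

Lemma pdvd_mull (S : comNzRingType) (a q r : S) : pdvd a r -> pdvd a (q * r).
Proof. by case=> g ->; exists (q * g); rewrite mulrA. Qed.

Lemma pdvd_mulr (S : comNzRingType) (a q r : S) : pdvd a r -> pdvd a (r * q).
Proof. by rewrite mulrC; exact: pdvd_mull. Qed.

Lemma pdvdD (S : comNzRingType) (a q r : S) :
  pdvd a q -> pdvd a r -> pdvd a (q + r).
Proof. by case=> g -> [h ->]; exists (g + h); rewrite mulrDl. Qed.

Lemma pdvdN (S : comNzRingType) (a q : S) : pdvd a q -> pdvd a (- q).
Proof. by case=> g ->; exists (- g); rewrite mulNr. Qed.

Lemma pdvdB (S : comNzRingType) (a q r : S) :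
  pdvd a q -> pdvd a r -> pdvd a (q - r).
Proof. by move=> dq dr; apply: pdvdD => //; apply: pdvdN. Qed.

Lemma pdvd_congD (S : comNzRingType) (a q q' r r' : S) :
  pdvd a (q - q') -> pdvd a (r - r') -> pdvd a (q + r - (q' + r')).
Proof. by move=> dq dr; rewrite opprD addrACA; apply: pdvdD. Qed.

Lemma pdvd_congM (S : comNzRingType) (a q q' r r' : S) :
  pdvd a (q - q') -> pdvd a (r - r') -> pdvd a (q * r - q' * r').
Proof.
move=> dq dr; have -> : q * r - q' * r' = q * (r - r') + (q - q') * r' by ring.
exact: pdvdD (pdvd_mull _ dr) (pdvd_mulr _ dq).
Qed.

Lemma pdvd_refl (S : comNzRingType) (a : S) : pdvd a a.
Proof. by exists 1; rewrite mul1r. Qed.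

Lemma pdvd_sum (S : comNzRingType) (a : S) (I : Type) (r : seq I) (F : I -> S) :
  (forall i, pdvd a (F i)) -> pdvd a (\sum_(i <- r) F i).
Proof.
move=> dF; elim/big_rec: _ => [|i q _ dq]; first by exists 0; rewrite mul0r.
exact: pdvdD.
Qed.

Definition pprime (S : comNzRingType) (a : S) : Prop :=
  [/\ a != 0, ~ pdvd a 1 & forall q r, pdvd a (q * r) -> pdvd a q \/ pdvd a r].

Lemma pprime_prod (S : comNzRingType) (a : S) (I : eqType) (r : seq I)
    (F : I -> S) :
  pprime a -> pdvd a (\prod_(i <- r) F i) -> exists2 i, i \in r & pdvd a (F i).
Proof.
move=> [_ a1 aM]; elim: r => [|i r ih]; first by rewrite big_nil.
rewrite big_cons => /aM[d|/ih[j jr dj]]; first by exists i; rewrite ?mem_head.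
by exists j; rewrite // in_cons jr orbT.
Qed.

Lemma pprime_exp (S : comNzRingType) (a q : S) (k : nat) :
  pprime a -> pdvd a (q ^+ k) -> pdvd a q.
Proof.
by move=> [_ a1 aM]; elim: k => [//|k ih]; rewrite exprS => /aM[|/ih].
Qed.

Lemma pprime_exp_dvdM (S : idomainType) (a q r : S) (k : nat) :
  pprime a -> ~ pdvd a q -> pdvd (a ^+ k) (q * r) -> pdvd (a ^+ k) r.
Proof.
move=> [a0 a1 aM] Naq; elim: k r => [|k ih] r.
  by exists r; rewrite expr0 mulr1.
move=> [g eg].
have [//|[h eh]] : pdvd a q \/ pdvd a r.
  by apply: aM; exists (g * a ^+ k); rewrite eg exprSr mulrA.
have [h' eh'] : pdvd (a ^+ k) h.
  apply: ih; exists g; apply: (mulIf a0).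
  by rewrite -mulrA -eh eg exprSr mulrA.
by exists h'; rewrite eh eh' exprSr mulrA.
Qed.

Lemma pprime_prod_dvd (S : idomainType) (I : eqType) (r : seq I)
    (a : I -> S) (k : I -> nat) (q : S) :
  uniq r -> {in r, forall i, pprime (a i)} ->
  {in r &, forall i j, i != j -> ~ pdvd (a i) (a j)} ->
  {in r, forall i, pdvd (a i ^+ k i) q} ->
  pdvd (\prod_(i <- r) a i ^+ k i) q.
Proof.
elim: r q => [|i r ih] q /=; first by move=> *; exists q; rewrite big_nil mulr1.
move=> /andP[ir ur] pa Na da; rewrite big_cons.
have [g eg] : pdvd (\prod_(j <- r) a j ^+ k j) q.
  apply: ih => // [j jr|j j' jr j'r|j jr].
  - by apply: pa; rewrite in_cons jr orbT.
  - by apply: Na; rewrite in_cons ?jr ?j'r orbT.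
  - by apply: da; rewrite in_cons jr orbT.
have [h eh] : pdvd (a i ^+ k i) g.
  apply: (@pprime_exp_dvdM _ _ (\prod_(j <- r) a j ^+ k j)).
  - by apply: pa; rewrite mem_head.
  - move=> d; have [j jr /pprime_exp dj] := pprime_prod (pa _ (mem_head _ _)) d.
    have ij : i != j by apply: contraNneq ir => ->.
    by apply: (Na i j _ _ ij); rewrite ?mem_head ?in_cons ?jr ?orbT //;
      apply: dj; apply: pa; rewrite mem_head.
  - by rewrite mulrC -eg; apply: da; rewrite mem_head.
by exists h; rewrite eg eh mulrA.
Qed.

(* Elimination without division: subtracting multiples of a pivot equation
   leaves one equation and one unknown less. *)
Lemma lin_dependent (S : idomainType) (r s : nat) (M : 'I_r -> 'I_s -> S) :
  (s < r)%N ->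
  exists2 c : 'I_r -> S, exists i, c i != 0
    & forall j, \sum_(i < r) c i * M i j = 0.
Proof.
elim: s r M => [|s ih] r M lt_sr.
  exists (fun=> 1); last by case.
  by exists (Ordinal lt_sr); rewrite oner_neq0.
case: r M lt_sr => // r M lt_sr.
have [/existsP[i0 Mi0]|/existsPn M0] := boolP [exists i, M i ord_max != 0].
  pose a := M i0 ord_max.
  have [c [i ci] cM] := ih r (fun i j => a * M (lift i0 i) (widen_ord (leqnSn s) j)
       - M (lift i0 i) ord_max * M i0 (widen_ord (leqnSn s) j)) lt_sr.
  exists (fun i => if unlift i0 i is Some k then c k * a else
                   - \sum_k c k * M (lift i0 k) ord_max).
    by exists (lift i0 i); rewrite liftK mulf_neq0.
  move=> j; rewrite (bigD1_ord i0) //= unlift_none.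
  under [X in _ + X]eq_bigr do rewrite liftK.
  have [->|jm] := eqVneq j ord_max.
    rewrite mulNr mulr_suml addrC -sumrB big1 // => k _.
    by rewrite /a -!mulrA [M i0 _ * _]mulrC subrr.
  have lt_js : (j < s)%N.
    by rewrite ltn_neqAle -ltnS ltn_ord andbT.
  have := cM (Ordinal lt_js); rewrite (_ : widen_ord _ _ = j); last exact: val_inj.
  move=> cM0; rewrite -[RHS]cM0 mulNr mulr_suml addrC -sumrB.
  by apply: eq_bigr => k _; rewrite mulrBr !mulrA.
have [c [i ci] cM] := ih r.+1 (fun i j => M i (widen_ord (leqnSn s) j)) (ltnW lt_sr).
exists c; first by exists i.
move=> j; have [->|jm] := eqVneq j ord_max.
  by apply: big1 => k _; have /negPn/eqP -> := M0 k; rewrite mulr0.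
have lt_js : (j < s)%N by rewrite ltn_neqAle -ltnS ltn_ord andbT.
have := cM (Ordinal lt_js); rewrite (_ : widen_ord _ _ = j) //; exact: val_inj.
Qed.

Lemma pihomog_mull (R : comNzRingType) (n b d : nat) (B p : {mpoly R[n]}) :
  B \is b.-homog ->
  pihomog mdeg d (B * p) =
  if (b <= d)%N then B * pihomog mdeg (d - b)%N p else 0.
Proof.
move=> hB; rewrite {1}(pihomog_partitionE (leqnn (mmeasure mdeg p))).
rewrite mulr_sumr linear_sum /=.
have H e : pihomog mdeg d (B * pihomog mdeg e p) =
    if (b + e == d)%N then B * pihomog mdeg e p else 0.
  have he : B * pihomog mdeg e p \is (b + e).-homog.
    by apply: dhomogM => //; apply: pihomogP.
  by case: eqP => [<-|/eqP ne]; [rewrite pihomog_dE | rewrite (pihomog_ne0 ne)].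
under eq_bigr do rewrite H.
rewrite -big_mkcond /=; case: leqP => [le_bd|lt_db]; last first.
  by apply: big1 => i /eqP ei; rewrite -ei ltnNge leq_addr in lt_db.
rewrite -mulr_sumr; congr (B * _).
rewrite [in RHS](pihomog_partitionE (leqnn (mmeasure mdeg p))) linear_sum /=.
rewrite big_mkcond; apply: eq_bigr => i _.
case: eqP => [<-|/eqP ne]; first by rewrite addKn pihomog_id.
rewrite (@pihomog_ne0 _ _ _ i) ?pihomogP //.
by apply: contra ne => /eqP ->; rewrite subnKC.
Qed.

Lemma dhomog_comp (R : comNzRingType) (n k d : nat)
    (t : n.-tuple {mpoly R[k]}) (p : {mpoly R[n]}) :
  (forall i, tnth t i \is 1.-homog) -> p \is d.-homog -> p \mPo t \is d.-homog.
Proof.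
move=> ht /dhomogP hp; rewrite comp_mpolyE big_seq.
apply: rpred_sum => m mp; apply: rpredZ.
have -> : d = (\sum_(i < n) m i)%N by rewrite -(hp m mp) /= mdegE.
elim/big_rec2: _ => [|i e q _ hq]; first exact: dhomog1.
by apply: dhomogM => //; rewrite -[X in ishomog1 X]mul1n dhomogMn.
Qed.

Lemma dhomog0C (R : comNzRingType) (n : nat) (p : {mpoly R[n]}) :
  p \is 0.-homog -> p = (p@_0)%:MP.
Proof.
move=> /dhomogP hp; apply/mpolyP => m; rewrite mcoeffC.
have [->|m0] := eqVneq m 0%MM; first by rewrite mulr1.
rewrite mulr0; apply/memN_msupp_eq0.
by apply/negP => /hp /eqP; rewrite mdeg_eq0 (negPf m0).
Qed.

(** * Linear forms and restriction to subspaces *)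

Section Forms.
Variables (R : realType) (V : vectType R).
Implicit Types (W U H : {vspace V}) (f g : 'Hom(V, R^o)) (w : V).

Definition hyp W f : {vspace V} := (lker f :&: W)%VS.

Definition nz_on W f : Prop := exists2 w, w \in W & f w != 0.

Lemma mem_hyp W f w : (w \in hyp W f) = (f w == 0) && (w \in W).
Proof. by rewrite memv_cap memv_ker. Qed.

Lemma hyp_sub W f : (hyp W f <= W)%VS.
Proof. exact: capvSr. Qed.

Lemma nz_onPn W f : ~ nz_on W f -> forall w, w \in W -> f w = 0.
Proof.
by move=> Nf w wW; apply/eqP; apply: contraT => fw; case: Nf; exists w.
Qed.

Lemma nz_onP W f : reflect (nz_on W f) (~~ (W <= lker f)%VS).
Proof.
apply: (iffP idP) => [/subvPn[w wW fw]|[w wW fw]].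
  by exists w => //; rewrite -memv_ker.
by apply/subvPn; exists w; rewrite ?memv_ker.
Qed.

Lemma nz_on_hyp W f : nz_on W f <-> hyp W f <> W.
Proof.
split=> [[w wW fw] e|ne]; first by move: wW; rewrite -e mem_hyp (negPf fw).
apply/nz_onP/negP => /capv_idPr e; exact: ne.
Qed.

Lemma proportional W f g :
  (forall w, w \in hyp W f -> g w = 0) ->
  exists c : R, forall w, w \in W -> g w = c *: f w.
Proof.
move=> fg; have [/nz_onP [w0 w0W fw0]|/negPn/subvP f0] := boolP (~~ (W <= lker f)%VS).
  exists ((f w0)^-1 * g w0) => w wW.
  have /fg : w - (f w / f w0) *: w0 \in hyp W f.
    rewrite mem_hyp rpredB ?rpredZ // andbT linearB linearZ /= subr_eq0.
    by rewrite /GRing.scale /= divfK.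
  rewrite linearB linearZ /= => /eqP; rewrite subr_eq0 => /eqP ->.
  by rewrite /GRing.scale /=; ring.
exists 0 => w wW; rewrite scale0r; apply: fg.
by rewrite mem_hyp wW -memv_ker f0.
Qed.

Lemma dim_hyp W f : nz_on W f -> (\dim (hyp W f)).+1 = \dim W.
Proof.
move=> nzf; have [w0 w0W fw0] := nzf.
have -> : W = (hyp W f + <[w0]>)%VS.
  apply/eqP; rewrite eqEsubv subv_add hyp_sub -memvE w0W !andbT.
  apply/subvP => w wW; apply/memv_addP.
  exists (w - (f w / f w0) *: w0); last first.
    by exists ((f w / f w0) *: w0); rewrite ?subrK // rpredZ // memv_line.
  rewrite mem_hyp rpredB ?rpredZ // andbT linearB linearZ /= subr_eq0.
  by rewrite /GRing.scale /= divfK.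
rewrite dimv_disjoint_sum ?dim_vline.
  have -> : w0 != 0 by apply: contraNneq fw0 => ->; rewrite linear0.
  suff -> : hyp (hyp W f + <[w0]>) f = hyp W f by rewrite addn1.
  apply/eqP; rewrite eqEsubv; apply/andP; split; apply/subvP => w.
    rewrite [in X in X -> _]mem_hyp => /andP[fw /memv_addP[u uH [v /vlineP[k ->] e]]].
    move: fw; rewrite e linearD linearZ /=.
    have /andP[/eqP -> _] : (f u == 0) && (u \in W) by rewrite -mem_hyp.
    rewrite add0r scaler_eq0 (negPf fw0) orbF => /eqP ->.
    by rewrite scale0r addr0.
  move=> wH; rewrite mem_hyp; move: (wH); rewrite mem_hyp => /andP[-> _] /=.
  by apply: subvP wH; apply: addvSl.
apply/eqP; rewrite -subv0; apply/subvP => w; rewrite memv_cap => /andP[].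
rewrite mem_hyp => /andP[fw _] /vlineP[k e]; move: fw; rewrite e linearZ /=.
rewrite scaler_eq0 (negPf fw0) orbF => /eqP k0.
by rewrite k0 scale0r mem0v.
Qed.

Definition coordf W (i : 'I_(\dim W)) : 'Hom(V, R^o) :=
  linfun (coord (vbasis W) i : V -> R^o).

Lemma coordfE W (i : 'I_(\dim W)) v : coordf i v = coord (vbasis W) i v.
Proof. by rewrite lfunE. Qed.

Lemma hyp_exists W H : (H <= W)%VS -> (\dim H).+1 = \dim W ->
  exists2 f, H = hyp W f & nz_on W f.
Proof.
move=> sHW dHW.
have [w0 w0W w0H] : exists2 w, w \in W & w \notin H.
  by apply/subvPn; apply/negP => /dimvS; rewrite -dHW ltnn.
pose p : 'End(V) := (\1 - projv H)%VF.
have pE v : p v = v - projv H v by rewrite add_lfunE opp_lfunE id_lfunE.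
have u0 : p w0 != 0.
  by rewrite pE subr_eq0; apply: contraNneq w0H => ->; exact: memv_proj.
have [i ci] : exists i, coord (vbasis fullv) i (p w0) != 0.
  apply/existsP; apply: contraT; rewrite negb_exists => /forallP c0.
  case/negP: u0; rewrite [p w0](coord_vbasis (memvf _)) big1 // => j _.
  by have /negPn/eqP -> := c0 j; rewrite scale0r.
pose f := (coordf i \o p)%VF.
have nzf : nz_on W f by exists w0 => //; rewrite comp_lfunE coordfE.
exists f => //; apply/eqP; rewrite eqEdim -ltnS dHW (dim_hyp nzf) leqnn andbT.
apply/subvP => v vH; rewrite mem_hyp (subvP sHW) // andbT comp_lfunE.
by rewrite pE projv_id // subrr linear0.
Qed.

Lemma vbasis_tnth W i : tnth (vbasis W) i \in W.
Proof. exact/vbasis_mem/mem_tnth. Qed.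

Lemma form_poly_ext W f g :
  (forall w, w \in W -> f w = g w) -> form_poly W f = form_poly W g.
Proof. by move=> e; apply: eq_bigr => i _; rewrite e ?vbasis_tnth. Qed.

Lemma form_polyP W (c : R) f g :
  form_poly W (c *: f + g) = c *: form_poly W f + form_poly W g.
Proof.
rewrite scaler_sumr -big_split; apply: eq_bigr => i _ /=.
by rewrite add_lfunE scale_lfunE scalerDl scalerA.
Qed.

Lemma form_poly0 W : form_poly W (0 : 'Hom(V, R^o)) = 0.
Proof. by apply: big1 => i _; rewrite lfunE scale0r. Qed.

Lemma form_polyZ W (c : R) f : form_poly W (c *: f) = c *: form_poly W f.
Proof. by rewrite -[c *: f]addr0 form_polyP form_poly0 addr0. Qed.

Lemma form_polyB W f g : form_poly W (f - g) = form_poly W f - form_poly W g.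
Proof. by rewrite -[- g]scaleN1r addrC form_polyP scaleN1r addrC. Qed.

Lemma form_poly_sum W (I : Type) (r : seq I) (c : I -> R) (F : I -> 'Hom(V, R^o)) :
  form_poly W (\sum_(i <- r) c i *: F i) = \sum_(i <- r) c i *: form_poly W (F i).
Proof.
elim: r => [|i r ih]; first by rewrite !big_nil form_poly0.
by rewrite !big_cons form_polyP ih.
Qed.

Lemma form_poly_homog W f : form_poly W f \is 1.-homog.
Proof.
by apply: rpred_sum => i _; apply: rpredZ; rewrite dhomogX /= mdeg1.
Qed.

Lemma coordf_id W f w : w \in W ->
  f w = (\sum_i f (tnth (vbasis W) i) *: coordf i) w.
Proof.
move=> wW; rewrite {1}(coord_vbasis wW) linear_sum sum_lfunE.
apply: eq_bigr => i _; rewrite linearZ scale_lfunE coordfE (tnth_nth 0) /=.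
by rewrite /GRing.scale /= mulrC.
Qed.

Lemma form_poly_coordf W (i : 'I_(\dim W)) : form_poly W (coordf i) = 'X_i.
Proof.
rewrite /form_poly (bigD1 i) //= big1 => [|j ji].
  by rewrite coordfE (tnth_nth 0) coord_free ?(basis_free (vbasisP W)) // eqxx scale1r addr0.
rewrite coordfE (tnth_nth 0) coord_free ?(basis_free (vbasisP W)) //.
by rewrite (negPf ji) scale0r.
Qed.

Lemma form_poly_eq0 W f : form_poly W f = 0 -> ~ nz_on W f.
Proof.
move=> f0 [w wW]; rewrite (coordf_id f wW) => /eqP; apply.
rewrite sum_lfunE big1 // => i _; rewrite scale_lfunE.
have /(congr1 (mcoeff U_(i))) := f0.
rewrite mcoeff0 /form_poly raddf_sum (bigD1 i) //= big1 => [|j ji].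
  by rewrite mcoeffZ mcoeffX eqxx mulr1 addr0 => ->; rewrite scale0r.
by rewrite mcoeffZ mcoeffXU (negPf ji) mulr0.
Qed.

(* The same formula serves both directions: for H <= W, [chg W H] restricts
   polynomial functions to H, and [chg H W] is a section of it. *)
Definition chg (W U : {vspace V}) : {mpoly R[\dim W]} -> {mpoly R[\dim U]} :=
  comp_mpoly [tuple form_poly U (coordf i) | i < \dim W].

Arguments chg W U _ : clear implicits.

HB.instance Definition _ W U := GRing.RMorphism.copy (chg W U)
  (comp_mpoly [tuple form_poly U (coordf i) | i < \dim W]).
HB.instance Definition _ W U := GRing.Linear.copy (chg W U)
  (comp_mpoly [tuple form_poly U (coordf i) | i < \dim W]).

Lemma chgX W U i : chg W U ('X_i : {mpoly R[\dim W]}) = form_poly U (coordf i).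
Proof. by rewrite /chg /= comp_mpolyXU -tnth_nth tnth_mktuple. Qed.

Lemma chgC W U c : chg W U (c%:MP : {mpoly R[\dim W]}) = c%:MP.
Proof. exact: comp_mpolyC. Qed.

Lemma chg_homog W U d (q : {mpoly R[\dim W]}) :
  q \is d.-homog -> chg W U q \is d.-homog.
Proof.
by apply: dhomog_comp => i; rewrite tnth_mktuple; exact: form_poly_homog.
Qed.

Lemma chg_form_sum W U f :
  chg W U (form_poly W f) =
  form_poly U (\sum_i f (tnth (vbasis W) i) *: coordf i).
Proof.
rewrite form_poly_sum {1}/form_poly linear_sum.
by apply: eq_bigr => i _; rewrite linearZ /= chgX.
Qed.

Lemma chg_form W H f : (H <= W)%VS -> chg W H (form_poly W f) = form_poly H f.
Proof.
move=> /subvP sHW; rewrite chg_form_sum; apply: form_poly_ext => w /sHW wW.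
by rewrite -coordf_id.
Qed.

Lemma chgK W H : (H <= W)%VS -> cancel (chg H W) (chg W H).
Proof.
move=> sHW; apply: mpoly_ring_ind => [c|i|p q ep eq|p q ep eq].
- by rewrite !chgC.
- by rewrite chgX chg_form ?form_poly_coordf.
- by rewrite !raddfD /= ep eq.
- by rewrite !rmorphM /= ep eq.
Qed.

Lemma form_poly_proportional W f g :
  (forall w, w \in hyp W f -> g w = 0) ->
  exists c : R, form_poly W g = c *: form_poly W f.
Proof.
move=> /proportional[c e]; exists c; rewrite -form_polyZ.
by apply: form_poly_ext => w wW; rewrite scale_lfunE e.
Qed.

Lemma chg_section W f (q : {mpoly R[\dim W]}) :
  pdvd (form_poly W f) (q - chg (hyp W f) W (chg W (hyp W f) q)).
Proof.
elim/mpoly_ring_ind: q => [c|i|p q dp dq|p q dp dq].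
- by rewrite !chgC subrr; exists 0; rewrite mul0r.
- rewrite chgX chg_form_sum -form_poly_coordf.
  set g := \sum_j _; have [c e] : exists c : R,
      form_poly W (coordf i - g) = c *: form_poly W f.
    apply: form_poly_proportional => w wH.
    by rewrite add_lfunE opp_lfunE -coordf_id // subrr.
  by exists c%:MP; rewrite mul_mpolyC -e form_polyB.
- rewrite (raddfD (chg W (hyp W f))) (raddfD (chg (hyp W f) W)).
  exact: pdvd_congD dp dq.
- rewrite (rmorphM (chg W (hyp W f))) (rmorphM (chg (hyp W f) W)).
  exact: pdvd_congM dp dq.
Qed.

Lemma chg_form_self W f : chg W (hyp W f) (form_poly W f) = 0.
Proof.
rewrite chg_form ?hyp_sub // -(form_poly0 (hyp W f)).
by apply: form_poly_ext => w; rewrite mem_hyp lfunE => /andP[/eqP].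
Qed.

Lemma pdvd_form W f (q : {mpoly R[\dim W]}) :
  pdvd (form_poly W f) q <-> chg W (hyp W f) q = 0.
Proof.
split=> [[g ->]|e]; first by rewrite rmorphM /= chg_form_self mulr0.
by have := chg_section f q; rewrite e raddf0 subr0.
Qed.

Lemma form_pprime W f : nz_on W f -> pprime (form_poly W f).
Proof.
move=> nzf; split.
- by apply/eqP => /form_poly_eq0.
- by move=> /pdvd_form; rewrite rmorph1 => /eqP; rewrite oner_eq0.
- move=> q r /pdvd_form; rewrite rmorphM => /eqP; rewrite mulf_eq0.
  by case/orP => /eqP /pdvd_form; [left|right].
Qed.

Lemma form_pdvd W f g : pdvd (form_poly W f) (form_poly W g) ->
  (hyp W f <= hyp W g)%VS.
Proof.
move=> /pdvd_form; rewrite chg_form ?hyp_sub // => /form_poly_eq0 /nz_onPn e.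
apply/subvP => w wf; rewrite mem_hyp e // eqxx /=.
exact: subvP (hyp_sub _ _) _ wf.
Qed.

End Forms.

Arguments chg {R V} W U _.

(** * Logarithmic derivations and their restriction to a hyperplane *)

Section Derivations.
Variables (R : realType) (n : nat).
Implicit Types (D E : {mpoly R[n]} -> {mpoly R[n]}) (p q : {mpoly R[n]}).

Lemma derD D p q : is_derivation D -> D (p + q) = D p + D q.
Proof. by move=> [lD _]; have := lD 1 p q; rewrite !scale1r. Qed.

Lemma der0 D : is_derivation D -> D 0 = 0.
Proof. by move=> dD; apply: (addrI (D 0)); rewrite -(derD _ _ dD) !addr0. Qed.

Lemma derZ D c p : is_derivation D -> D (c *: p) = c *: D p.
Proof. by move=> dD; have := dD.1 c p 0; rewrite !addr0 (der0 dD) addr0. Qed.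

Lemma derM D p q : is_derivation D -> D (p * q) = D p * q + p * D q.
Proof. by case. Qed.

Lemma derC D c : is_derivation D -> D c%:MP = 0.
Proof.
move=> dD; have D1 : D 1 = 0.
  by apply: (addrI (D 1)); rewrite addr0 -{3}[1]mulr1 (derM _ _ dD) mulr1 mul1r.
by rewrite -[c%:MP]mulr1 mul_mpolyC (derZ _ _ dD) D1 scaler0.
Qed.

Lemma derB D p q : is_derivation D -> D (p - q) = D p - D q.
Proof. by move=> dD; rewrite -scaleN1r (derD _ _ dD) (derZ _ _ dD) scaleN1r. Qed.

Lemma der_sum D (I : Type) (r : seq I) (F : I -> {mpoly R[n]}) :
  is_derivation D -> D (\sum_(i <- r) F i) = \sum_(i <- r) D (F i).
Proof.
by move=> dD; apply: (big_morph D (fun p q => derD p q dD) (der0 dD)).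
Qed.

Lemma der_ext D E : is_derivation D -> is_derivation E ->
  (forall i, D 'X_i = E 'X_i) -> D =1 E.
Proof.
move=> dD dE DE; apply: mpoly_ring_ind => [c|//|p q ep eq|p q ep eq].
- by rewrite (derC _ dD) (derC _ dE).
- by rewrite (derD _ _ dD) (derD _ _ dE) ep eq.
- by rewrite (derM _ _ dD) (derM _ _ dE) ep eq.
Qed.

Lemma der_comb (I : finType) (g : I -> {mpoly R[n]})
    (D : I -> {mpoly R[n]} -> {mpoly R[n]}) :
  (forall i, is_derivation (D i)) ->
  is_derivation (fun q => \sum_i g i * D i q).
Proof.
move=> dD; split=> [c p q|p q].
  rewrite scaler_sumr -big_split; apply: eq_bigr => i _ /=.
  by rewrite (dD i).1 mulrDr scalerAr.
rewrite mulr_suml mulr_sumr -big_split; apply: eq_bigr => i _ /=.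
by rewrite (derM _ _ (dD i)); ring.
Qed.

Lemma der_partial (i : 'I_n) : is_derivation (mderiv i : {mpoly R[n]} -> _).
Proof. by split=> [c p q|p q]; rewrite ?linearP ?mderivM. Qed.

Lemma mderiv_X (i j : 'I_n) : mderiv i ('X_j : {mpoly R[n]}) = (i == j)%:R.
Proof.
rewrite mderivX mnm1E eq_sym; case: eqP => [->|_]; last by rewrite scale0r.
rewrite scale1r (_ : (U_(j) - U_(j))%MM = 0%MM) ?mpolyX0 //.
by apply/mnmP => k; rewrite mnmBE subnn mnm0E.
Qed.

Lemma der_basis (t : 'I_n -> {mpoly R[n]}) :
  exists2 D, is_derivation D & forall i, D 'X_i = t i.
Proof.
exists (fun q => \sum_j t j * mderiv j q); first exact/der_comb/der_partial.
move=> i; rewrite (bigD1 i) //= mderiv_X eqxx mulr1 big1 ?addr0 // => j ji.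
by rewrite mderiv_X (negPf ji) mulr0.
Qed.

End Derivations.

Section LogDerivations.
Variables (R : realType) (V : vectType R).
Implicit Types (W H K X : {vspace V}) (A : {fset {vspace V}}).

Lemma der_form W D (f : 'Hom(V, R^o)) : is_derivation D ->
  D (form_poly W f) = \sum_i f (tnth (vbasis W) i) *: D 'X_i.
Proof. by move=> dD; rewrite (der_sum _ _ dD); apply: eq_bigr => i _; rewrite (derZ _ _ dD). Qed.

Lemma der_form_homog W D (f : 'Hom(V, R^o)) d : is_derivation D ->
  (forall i, D 'X_i \is d.-homog) -> D (form_poly W f) \is d.-homog.
Proof.
by move=> dD hD; rewrite (der_form _ dD); apply: rpred_sum => i _; apply: rpredZ.
Qed.

Lemma form_ofP W K : exists f : 'Hom(V, R^o),
  (K <= W)%VS && ((\dim K).+1 == \dim W) ==> (K == hyp W f).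
Proof.
have [/andP[sKW /eqP dK]|] := boolP (_ && _); last by exists 0.
by have [f -> _] := hyp_exists sKW dK; exists f; rewrite eqxx.
Qed.

Definition form_of W K : 'Hom(V, R^o) := xchoose (form_ofP W K).

Lemma hyp_form_of W K : (K <= W)%VS -> (\dim K).+1 = \dim W ->
  hyp W (form_of W K) = K.
Proof.
move=> sKW dK; apply/esym/eqP/(implyP (xchooseP (form_ofP W K))).
by rewrite sKW dK eqxx.
Qed.

Lemma nz_form_of W K : (K <= W)%VS -> (\dim K).+1 = \dim W ->
  nz_on W (form_of W K).
Proof.
move=> sKW dK; apply/nz_on_hyp; rewrite hyp_form_of // => e.
by move: dK; rewrite e => /eqP; rewrite eqn_leq ltnn.
Qed.

Definition mult A H X : nat := count (fun K => (K :&: H)%VS == X) A.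

Section Restriction.
Variables (W : {vspace V}) (A : {fset {vspace V}}) (f0 : 'Hom(V, R^o)).
Hypotheses (arrA : is_arrangement W A) (nz0 : nz_on W f0).
Local Notation H := (hyp W f0).
Hypothesis HA : H \notin A.
Local Notation alpha := (form_poly W f0).
Local Notation phi := (chg W H).
Local Notation restrA := [fset (K :&: H)%VS | K in A]%fset.

Lemma arr_eq K K' : K \in A -> K' \in A -> (K <= K')%VS -> K = K'.
Proof.
move=> /arrA[_ dK] /arrA[_ dK'] sKK'; apply/eqP.
by rewrite eqEdim sKK' -ltnS dK dK' leqnn.
Qed.

Lemma nz_on_restr K : K \in A -> nz_on H (form_of W K).
Proof.
move=> KA; have [sKW dK] := arrA KA; apply/nz_onP/negP => /subvP sHK.
have : (H <= K)%VS.
  apply/subvP => w wH; rewrite -(hyp_form_of sKW dK) mem_hyp -memv_ker sHK //.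
  exact: subvP (hyp_sub _ _) _ wH.
move=> sH; case/negP: HA; suff -> : H = K by [].
by apply/eqP; rewrite eqEdim sH -ltnS dK (dim_hyp nz0) leqnn.
Qed.

Lemma hyp_restr K : K \in A -> hyp H (form_of W K) = (K :&: H)%VS.
Proof.
move=> KA; have [sKW dK] := arrA KA; rewrite -{2}(hyp_form_of sKW dK) /hyp.
by rewrite -!capvA; congr (_ :&: _)%VS; rewrite [(W :&: _)%VS]capvC -capvA capvv.
Qed.

Lemma restrA_hyp X : X \in restrA -> (X <= H)%VS /\ (\dim X).+1 = \dim H.
Proof.
case/imfsetP => K /= KA ->; rewrite -(hyp_restr KA); split.
  exact: hyp_sub.
exact/dim_hyp/nz_on_restr.
Qed.

Lemma log_der_form D K : log_derivation W A D -> K \in A ->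
  pdvd (form_poly W (form_of W K)) (D (form_poly W (form_of W K))).
Proof.
move=> [_ lD] KA; have [sKW dK] := arrA KA.
by apply: (lD K KA); rewrite -{1}(hyp_form_of sKW dK).
Qed.

(* The 2-form alpha ^ alpha_K evaluated on D and the Euler derivation vanishes
   on every hyperplane of A through X. *)
Lemma mult_dvd D X : log_derivation W A D -> X \in restrA ->
  pdvd (form_poly H (form_of H X) ^+ (mult A H X).-1) (phi (D alpha)).
Proof.
move=> lD XA; have [sXH dX] := restrA_hyp XA.
pose a K := form_poly W (form_of W K); pose aX := form_poly H (form_of H X).
pose s := [seq K <- A | (K :&: H)%VS == X].
have [K0 K0A eX] : exists2 K, K \in A & X = (K :&: H)%VS.
  by case/imfsetP: XA => K /= ? ->; exists K.
have sA K : K \in s -> K \in A by rewrite mem_filter => /andP[].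
have sX K : K \in s -> (K :&: H)%VS = X by rewrite mem_filter => /andP[/eqP].
pose delta := alpha * D (a K0) - a K0 * D alpha.
have aX_dvd K : K \in s -> exists c : R, phi (a K) = c *: aX.
  move=> Ks; rewrite chg_form ?hyp_sub //; apply: form_poly_proportional => w.
  rewrite hyp_form_of // -(sX K Ks) -hyp_restr ?sA //.
  by rewrite mem_hyp => /andP[/eqP].
have dvd_aX : exists c : R, aX = c *: phi (a K0).
  rewrite chg_form ?hyp_sub //; apply: form_poly_proportional => w.
  rewrite hyp_restr // -eX -{1}(hyp_form_of sXH dX) mem_hyp.
  by case/andP => /eqP.
have dvd_delta : pdvd (\prod_(K <- s) a K ^+ 1) delta.
  apply: pprime_prod_dvd => [|K Ks|K K' Ks K's KK'|K Ks].
  - exact/filter_uniq/fset_uniq.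
  - by have [sKW dK] := arrA (sA _ Ks); apply: form_pprime; apply: nz_form_of.
  - move=> /form_pdvd; have [sKW dK] := arrA (sA _ Ks).
    have [sKW' dK'] := arrA (sA _ K's); rewrite !hyp_form_of // => /arr_eq.
    by move=> e; case/eqP: KK'; apply: e; exact: sA.
  rewrite expr1; have [->|KK0] := eqVneq K K0.
    apply: pdvdB; first by apply: pdvd_mull; apply: log_der_form.
    by apply: pdvd_mulr; apply: pdvd_refl.
  have [sKW dK] := arrA (sA _ Ks); have [sKW0 dK0] := arrA K0A.
  have [c ec] : exists c : R, forall w, w \in H ->
      form_of W K w = c *: form_of W K0 w.
    apply: proportional => w; rewrite hyp_restr // -eX -(sX _ Ks) -hyp_restr ?sA //.
    by rewrite mem_hyp => /andP[/eqP].
  have [d ed] : exists d : R, forall w, w \in W ->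
      (form_of W K - c *: form_of W K0) w = d *: f0 w.
    apply: proportional => w wH.
    by rewrite add_lfunE opp_lfunE scale_lfunE ec ?subrr.
  have ea : a K - c *: a K0 = d *: alpha.
    rewrite -!form_polyZ -form_polyB; apply: form_poly_ext => w wW.
    by rewrite ed // scale_lfunE.
  have d0 : d != 0.
    apply: contraNneq KK0 => d0; apply/eqP/esym/arr_eq => //; first exact: sA.
    rewrite -(hyp_form_of sKW0 dK0) -(hyp_form_of sKW dK).
    apply: form_pdvd; exists c%:MP; rewrite mul_mpolyC.
    by apply/eqP; rewrite -subr_eq0 ea d0 scale0r.
  have dD := lD.1.
  have eD : D (a K) - c *: D (a K0) = d *: D alpha by rewrite -!(derZ _ _ dD) -(derB _ _ dD) ea.
  have -> : delta = d^-1%:MP * (a K * D (a K0) - a K0 * D (a K)).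
    apply: (@mulfI _ d%:MP); first by rewrite mpolyC_eq0.
    rewrite mulrA -mpolyCM mulfV // mul1r mul_mpolyC scalerBr scalerAl scalerAr.
    by rewrite -ea -eD -!mul_mpolyC; ring.
  apply: pdvd_mull; apply: pdvdB; first by apply: pdvd_mulr; apply: pdvd_refl.
  by apply: pdvd_mull; apply: log_der_form => //; apply: sA.
have phi_delta : phi delta = - (phi (a K0) * phi (D alpha)).
  by rewrite rmorphB !rmorphM /= chg_form_self mul0r add0r.
have [q eq] : pdvd (aX ^+ size s) (phi delta).
  have [g ->] := dvd_delta; rewrite rmorphM; apply: pdvd_mull.
  rewrite rmorph_prod; elim: (s) aX_dvd => [|K s' ih] sdvd.
    by rewrite big_nil; apply: pdvd_refl.
  rewrite big_cons /= expr1; have [|c ->] := sdvd K; first exact: mem_head.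
  have [|r ->] := ih; first by move=> K' K's; apply: sdvd; rewrite in_cons K's orbT.
  by exists (c%:MP * r); rewrite -mul_mpolyC exprS; ring.
have [c ec] := dvd_aX.
have aX0 : aX != 0 by have [] := form_pprime (nz_form_of sXH dX).
have ms : mult A H X = size s by rewrite /mult size_filter.
have : (0 < mult A H X)%N.
  by rewrite ms -has_predT; apply/hasP; exists K0; rewrite // mem_filter K0A -eX eqxx.
rewrite ms -/aX; case: (size s) eq => // k eq _ /=.
exists (- (c%:MP * q)); apply: (mulfI aX0).
rewrite {1}ec -mul_mpolyC -mulrA -[phi (a K0) * _]opprK -phi_delta eq exprS; ring.
Qed.

Lemma mult_sum : (\sum_(X <- restrA) (mult A H X).-1 + #|` restrA| = #|` A|)%N.
Proof.
rewrite -!sum1_size -big_split /=.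
rewrite [RHS](partition_big_imfset _ (fun K => (K :&: H)%VS)) /=.
rewrite big_seq [RHS]big_seq; apply: eq_bigr => X XA.
rewrite sum1_count addn1 prednK // -has_count; apply/hasP.
by case/imfsetP: XA => K /= KA ->; exists K.
Qed.

Lemma restriction_bound b : (#|` restrA| + b = #|` A|)%N ->
  exists B : {mpoly R[\dim H]}, [/\ B != 0, B \is b.-homog &
    forall D, log_derivation W A D -> pdvd B (phi (D alpha))].
Proof.
move=> eb; exists (\prod_(X <- restrA) form_poly H (form_of H X) ^+ (mult A H X).-1).
split.
- rewrite prodf_seq_neq0; apply/allP => X XA /=.
  have [sXH dX] := restrA_hyp XA; rewrite expf_neq0 //.
  by have [] := form_pprime (nz_form_of sXH dX).
- have -> : b = (\sum_(X <- restrA) (mult A H X).-1)%N.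
    by apply/eqP; rewrite -(eqn_add2l #|` restrA|) eb -mult_sum addnC.
  elim/big_rec2: _ => [|X e q _ hq]; first exact: dhomog1.
  apply: dhomogM => //; rewrite -[X in ishomog1 X]mul1n dhomogMn //.
  exact: form_poly_homog.
- move=> D lD; apply: pprime_prod_dvd => [|X XA|X X' XA XA' XX'|X XA].
  + exact: fset_uniq.
  + by have [sXH dX] := restrA_hyp XA; apply: form_pprime; apply: nz_form_of.
  + move=> /form_pdvd; have [sXH dX] := restrA_hyp XA.
    have [sXH' dX'] := restrA_hyp XA'; rewrite !hyp_form_of // => s.
    by case/negP: XX'; rewrite eqEdim s -ltnS dX dX' leqnn.
  + exact: mult_dvd.
Qed.

End Restriction.
End LogDerivations.

(** * The addition theorem *)

Lemma lin_dependent_on (S : idomainType) (I J : finType) (P : pred I)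
    (Q : pred J) (M : I -> J -> S) : (#|Q| < #|P|)%N ->
  exists c : I -> S, [/\ exists2 i, P i & c i != 0,
    forall i, ~~ P i -> c i = 0 & forall j, Q j -> \sum_i c i * M i j = 0].
Proof.
move=> ltQP; pose MP (i : 'I_#|P|) (j : 'I_#|Q|) := M (enum_val i) (enum_val j).
have [c [i0 ci0] cM] := lin_dependent MP ltQP.
pose d i := \sum_(k | enum_val k == i) c k.
have dE k : d (enum_val k) = c k.
  by rewrite /d (eq_bigl (pred1 k)) ?big_pred1_eq // => k' /=; rewrite (inj_eq enum_val_inj).
exists d; split.
- by exists (enum_val i0); [exact: (enum_valP i0)|rewrite dE].
- move=> i Pi; apply: big_pred0 => k; apply/negP => /eqP ei.
  by case/negP: Pi; rewrite -ei; exact: (enum_valP k).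
- move=> j Qj; rewrite -[RHS](cM (enum_rank_in Qj j)) /MP.
  rewrite (partition_big (fun k : 'I_#|P| => enum_val k) predT) //=.
  apply: eq_bigr => i _; rewrite mulr_suml; apply: eq_bigr => k /eqP <-.
  by rewrite enum_rankK_in.
Qed.

Lemma card_nth_pred (e : seq nat) (p : pred nat) :
  #|[pred i : 'I_(size e) | p (nth 0%N e i)]| = count p e.
Proof.
by rewrite -sum1_card -sum1_count (big_nth 0%N) big_mkord.
Qed.

Section Exponents.
Variables (R : realType) (V : vectType R).
Implicit Types (W H K X : {vspace V}) (A : {fset {vspace V}}).

Lemma has_exponentsI W A r (D : 'I_r -> {mpoly R[\dim W]} -> {mpoly R[\dim W]})
    (deg : 'I_r -> nat) e :
  log_basis W A D -> (forall i j, D i 'X_j \is (deg i).-homog) ->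
  perm_eq e [seq deg i | i <- enum 'I_r] -> has_exponents W A e.
Proof.
move=> [lD sD iD] hD pe; have er : size e = r.
  by rewrite (perm_size pe) size_map size_enum_ord.
case: r / er D deg lD sD iD hD pe => D deg lD sD iD hD pe.
have [s es] : exists s : 'S_(size e), forall i : 'I_(size e), nth 0%N e i = deg (s i).
  have /tuple_permP[s es] : perm_eq (in_tuple e) (map_tuple deg (ord_tuple (size e))) by [].
  exists s => i; have -> : nth 0%N e i = nth 0%N (in_tuple e) i by [].
  by rewrite es -tnth_nth tnth_mktuple tnth_map tnth_ord_tuple.
exists (fun i => D (s i)); last by move=> i j; rewrite es.
split=> [i|E /sD[g gE]|g g0 i]; first exact: lD.
  by exists (fun i => g (s i)) => q; rewrite gE (reindex_inj (@perm_inj _ s)).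
rewrite -(permK s i); apply: (iD (fun i => g ((s^-1)%g i))) => q.
rewrite (reindex_inj (@perm_inj _ s)) /= -[RHS](g0 q).
by apply: eq_bigr => j _; rewrite permK.
Qed.

Lemma has_exponents_perm W A e e' :
  perm_eq e e' -> has_exponents W A e -> has_exponents W A e'.
Proof.
move=> pe [D bD hD]; apply: (has_exponentsI bD hD).
rewrite perm_sym (_ : map _ _ = e) //.
rewrite (map_comp (nth 0%N e) val) val_enum_ord; exact: mkseq_nth.
Qed.

Lemma has_exponents_empty W : has_exponents W fset0 (nseq (\dim W) 0%N).
Proof.
pose D (i : 'I_(\dim W)) : {mpoly R[\dim W]} -> {mpoly R[\dim W]} := mderiv i.
apply: (@has_exponentsI _ _ _ D (fun=> 0%N)); last 2 first.
- move=> i j; rewrite /D mderiv_X; case: (i == j); last exact: dhomog0.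
  exact: dhomog1.
- rewrite (_ : map _ _ = nseq (\dim W) 0%N) //.
  by rewrite -[in RHS](size_enum_ord (\dim W)); elim: (enum _) => //= a s ->.
split.
- by move=> i; split; [exact: der_partial|move=> K; rewrite in_fset0].
- move=> E [dE _]; exists (fun i => E 'X_i); apply: (der_ext dE).
    exact/der_comb/der_partial.
  move=> i; rewrite (bigD1 i) //= /D mderiv_X eqxx mulr1 big1 ?addr0 // => j ji.
  by rewrite mderiv_X (negPf ji) mulr0.
- move=> g g0 i; have := g0 'X_i.
  rewrite (bigD1 i) //= /D mderiv_X eqxx mulr1 big1 ?addr0 // => j ji.
  by rewrite mderiv_X (negPf ji) mulr0.
Qed.

Section Addition.
Variables (W : {vspace V}) (A : {fset {vspace V}}) (f0 : 'Hom(V, R^o)).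
Hypotheses (arrA : is_arrangement W A) (nz0 : nz_on W f0).
Local Notation H := (hyp W f0).
Hypothesis HA : H \notin A.
Local Notation alpha := (form_poly W f0).
Local Notation phi := (chg W H).
Local Notation sigma := (chg H W).
Local Notation restrA := [fset (K :&: H)%VS | K in A]%fset.

Lemma log_der_comb A' (I : finType) (g : I -> {mpoly R[\dim W]}) D :
  (forall i, log_derivation W A' (D i)) ->
  log_derivation W A' (fun q => \sum_i g i * D i q).
Proof.
move=> lD; split; first by apply: der_comb => i; case: (lD i).
move=> K KA f eK; apply: pdvd_sum => i; apply: pdvd_mull.
by have [_ l] := lD i; apply: l eK.
Qed.

Lemma log_der_addE D : log_derivation W (H |` A)%fset D <->
  log_derivation W A D /\ phi (D alpha) = 0.
Proof.
split=> [[dD lD]|[[dD lD] /pdvd_form Da]].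
  split; first by split=> // K KA; apply: lD; rewrite in_fset1U KA orbT.
  by apply/pdvd_form/(lD H) => //; rewrite in_fset1U eqxx.
split=> // K; rewrite in_fset1U => /orP[/eqP -> f eH|KA]; last exact: lD.
have [c ec] : exists c : R, alpha = c *: form_poly W f.
  by apply: form_poly_proportional => w; rewrite /hyp -eH mem_hyp => /andP[/eqP].
have [d ed] : exists d : R, form_poly W f = d *: alpha.
  by apply: form_poly_proportional => w; rewrite eH mem_hyp => /andP[/eqP].
rewrite ed (derZ _ _ dD); have [g ->] := Da; exists g.
by rewrite scalerAr.
Qed.

Lemma restrict_chg D q : is_derivation D -> phi (D alpha) = 0 ->
  phi (D (sigma (phi q))) = phi (D q).
Proof.
move=> dD Da; have [g /eqP] := chg_section f0 q.
rewrite subr_eq addrC -subr_eq => /eqP <-.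
rewrite (derB _ _ dD) (derM _ _ dD) rmorphB rmorphD !rmorphM /= Da.
by rewrite chg_form_self !mulr0 addr0 subr0.
Qed.

Lemma restrict_log_der D : log_derivation W A D -> phi (D alpha) = 0 ->
  log_derivation H restrA (fun q => phi (D (sigma q))).
Proof.
move=> lD Da; have dD := lD.1; split.
  split=> [c p q|p q]; first by rewrite linearP dD.1 linearP.
  by rewrite rmorphM /= (derM _ _ dD) rmorphD !rmorphM /= !chgK ?hyp_sub.
move=> X /imfsetP[K /= KA ->] f eX.
have [c ->] : exists c : R, form_poly H f = c *: form_poly H (form_of W K).
  apply: form_poly_proportional => w; rewrite (hyp_restr f0 arrA KA) eX mem_hyp.
  by case/andP => /eqP.
rewrite linearZ /= (derZ _ _ dD) linearZ /=.
rewrite -(chg_form (form_of W K) (hyp_sub W f0)) restrict_chg //.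
have [g ->] := log_der_form arrA lD KA.
by exists (phi g); rewrite rmorphM scalerAr.
Qed.

Lemma log_der_divide D : log_derivation W A D -> (forall q, phi (D q) = 0) ->
  exists2 E, log_derivation W A E & forall q, D q = alpha * E q.
Proof.
move=> lD D0.
have /fin_all_exists[t et] (j : 'I_(\dim W)) : exists u, D 'X_j = u * alpha.
  by have /pdvd_form[u eu] := D0 'X_j; exists u.
have [E dE eE] := der_basis t.
have DE : forall q, D q = alpha * E q.
  apply: der_ext => [||j]; [exact: lD.1| |by rewrite et eE mulrC].
  split=> [c p q|p q]; first by rewrite dE.1 mulrDr scalerAr.
  by rewrite (derM _ _ dE); ring.
exists E => //; split=> // K KA f eK.
have [sKW dK] := arrA KA.
have nzf : nz_on W f.
  by apply/nz_on_hyp; rewrite /hyp -eK => e; move: dK; rewrite e => /eqP; rewrite eqn_leq ltnn.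
have [_ _ primef] := form_pprime nzf.
have [|/form_pdvd|//] := primef alpha (E (form_poly W f)).
  by rewrite -DE; apply: lD.2 eK.
rewrite {1}/hyp -eK => sKH; case/negP: HA; suff <- : K = H by [].
by apply/eqP; rewrite eqEdim sKH -ltnS dK (dim_hyp nz0) leqnn.
Qed.

Lemma pivot_derivation e1 e2 b
    (D : 'I_(size e1) -> {mpoly R[\dim W]} -> {mpoly R[\dim W]}) :
  log_basis W A D -> (forall i j, D i 'X_j \is (nth 0%N e1 i).-homog) ->
  has_exponents H restrA e2 -> perm_eq e1 (b :: e2) ->
  (#|` restrA| + b = #|` A|)%N ->
  exists2 i0 : 'I_(size e1), nth 0%N e1 i0 = b & phi (D i0 alpha) != 0 /\
    forall E, log_derivation W A E -> pdvd (phi (D i0 alpha)) (phi (E alpha)).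
Proof.
move=> [lD sD iD] hD [eta [leta seta _] heta] pe /(restriction_bound arrA nz0 HA).
move=> [B [B0 hB dB]].
have hphi i : phi (D i alpha) \is (nth 0%N e1 i).-homog.
  by apply/chg_homog/der_form_homog/hD; exact: (lD i).1.
have [/existsP[i0 /andP[/eqP ei0 Di0]]|] :=
    boolP [exists i : 'I_(size e1), (nth 0%N e1 i == b) && (phi (D i alpha) != 0)].
  exists i0; rewrite // Di0; split=> // E /dB[k ->].
  have [k0 ek0] := dB _ (lD i0).
  have ek : phi (D i0 alpha) = (pihomog mdeg 0 k0)@_0 *: B.
    rewrite -mul_mpolyC -dhomog0C ?pihomogP // mulrC -(subnn b).
    rewrite -[LHS](pihomog_dE (hphi i0)) ek0 [k0 * B]mulrC ei0.
    by rewrite (pihomog_mull _ _ hB) leqnn.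
  move: Di0; rewrite ek; set c := mcoeff _ _.
  rewrite scaler_eq0 negb_or => /andP[c0 _]; exists ((c^-1)%:MP * k).
  by rewrite -mul_mpolyC mulrACA -mpolyCM mulVf // mul1r.
rewrite negb_exists => /forallP Nb; exfalso.
pose P := [pred i : 'I_(size e1) | nth 0%N e1 i <= b]%N.
pose Q := [pred j : 'I_(size e2) | nth 0%N e2 j <= b]%N.
have DP (i : 'I_(size e1)) : P i -> phi (D i alpha) = 0.
  rewrite /= leq_eqVlt => /orP[eb|ltb].
    by have := Nb i; rewrite eb /= negbK => /eqP.
  have [k ek] := dB _ (lD i).
  rewrite -[LHS](pihomog_dE (hphi i)) ek mulrC (pihomog_mull _ _ hB).
  by rewrite leqNgt ltb.
have /fin_all_exists[m em] (i : 'I_(size e1)) :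
    exists m : 'I_(size e2) -> {mpoly R[\dim H]},
    P i -> forall q, phi (D i (sigma q)) = \sum_j m j * eta j q.
  have [Pi|] := boolP (P i); last by exists (fun=> 0).
  by have [g] := seta _ (restrict_log_der (lD i) (DP i Pi)); exists g.
pose M (i : 'I_(size e1)) (j : 'I_(size e2)) := if (nth 0%N e2 j <= nth 0%N e1 i)%N
  then pihomog mdeg (nth 0%N e1 i - nth 0%N e2 j)%N (m i j) else 0.
have eM (i : 'I_(size e1)) q : P i -> phi (D i (sigma q)) = \sum_j M i j * eta j q.
  move=> Pi; move: q; apply: der_ext.
  - exact: (restrict_log_der (lD i) (DP i Pi)).1.
  - by apply: der_comb => j; case: (leta j).
  move=> k; have hk : phi (D i (sigma 'X_k)) \is (nth 0%N e1 i).-homog.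
    apply/chg_homog; rewrite chgX; apply/der_form_homog/hD; exact: (lD i).1.
  rewrite -(pihomog_dE hk) em // linear_sum; apply: eq_bigr => j _ /=.
  rewrite mulrC (pihomog_mull _ _ (heta j k)) /M; case: ifP => _; last by rewrite mul0r.
  by rewrite mulrC.
have ltQP : (#|Q| < #|P|)%N.
  rewrite (card_nth_pred e1 (fun x => x <= b)%N) (card_nth_pred e2 (fun x => x <= b)%N).
  by rewrite (seq.permP pe) /= leqnn.
have [c [[i Pi ci] cP cM]] := lin_dependent_on M ltQP.
have lT := log_der_comb (fun i => sigma (c i)) lD.
have [|E /sD[g eg] eE] := log_der_divide lT.
  move=> q; rewrite rmorph_sum /=.
  have -> : \sum_i phi (sigma (c i) * D i q) = \sum_i c i * \sum_j M i j * eta j (phi q).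
    apply: eq_bigr => k _; rewrite rmorphM /= chgK ?hyp_sub //.
    have [Pk|/cP ->] := boolP (P k); last by rewrite !mul0r.
    by rewrite -(eM _ _ Pk) (restrict_chg _ (lD k).1 (DP _ Pk)).
  under eq_bigr do rewrite mulr_sumr.
  rewrite exchange_big big1 // => j _ /=.
  under eq_bigr do rewrite mulrA.
  rewrite -mulr_suml; have [/cM ->|NQ] := boolP (Q j); first by rewrite mul0r.
  rewrite big1 ?mul0r // => k _.
  have [Pk|/cP ->] := boolP (P k); last by rewrite mul0r.
  by rewrite /M leqNgt (leq_ltn_trans Pk) ?mulr0 // ltnNge.
case/eqP: ci; rewrite -(chgK (hyp_sub W f0) (c i)).
have /eqP : sigma (c i) - alpha * g i = 0.
  apply: (iD (fun i => sigma (c i) - alpha * g i)) => q.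
  under eq_bigr do rewrite mulrBl -mulrA.
  by rewrite sumrB -mulr_sumr -eg -eE subrr.
by rewrite subr_eq0 => /eqP ->; rewrite rmorphM /= chg_form_self mul0r.
Qed.

Lemma addition_exponents e1 e2 b :
  has_exponents W A e1 -> has_exponents H restrA e2 -> perm_eq e1 (b :: e2) ->
  (#|` restrA| + b = #|` A|)%N ->
  has_exponents W (H |` A)%fset (b.+1 :: e2).
Proof.
move=> [D bD hD] he2 pe eb; have [i0 ei0 [h0 dh]] := pivot_derivation bD hD he2 pe eb.
have [lD sD iD] := bD; set h := phi (D i0 alpha) in h0 dh.
have hh i : phi (D i alpha) \is (nth 0%N e1 i).-homog.
  by apply/chg_homog/der_form_homog/hD; exact: (lD i).1.
have hb : h \is b.-homog by rewrite -ei0; apply: hh.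
have /fin_all_exists[k ek] (i : 'I_(size e1)) : exists k : {mpoly R[\dim H]},
    phi (D i alpha) = k * h /\ (if (b <= nth 0%N e1 i)%N
      then k \is (nth 0%N e1 i - b).-homog else k == 0).
  have [k ek] := dh _ (lD i).
  exists (if (b <= nth 0%N e1 i)%N then pihomog mdeg (nth 0%N e1 i - b) k else 0).
  rewrite -[phi (D i alpha)](pihomog_dE (hh i)) ek mulrC.
  by rewrite (pihomog_mull _ _ hb); case: ifP => _; rewrite ?mul0r ?eqxx // mulrC pihomogP.
pose D' (i : 'I_(size e1)) q := if i == i0 then alpha * D i0 q else D i q - sigma (k i) * D i0 q.
pose deg (i : 'I_(size e1)) := if i == i0 then b.+1 else nth 0%N e1 i.
have dD i := (lD i).1.
have lD' i : log_derivation W (H |` A)%fset (D' i).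
  rewrite /D'; case: eqP => _; apply/log_der_addE; split.
  - split; last by move=> K KA f eK; apply: pdvd_mull; apply: (lD i0).2 eK.
    split=> [c p q|p q]; first by rewrite (dD i0).1 mulrDr scalerAr.
    by rewrite (derM _ _ (dD i0)); ring.
  - by rewrite rmorphM /= chg_form_self mul0r.
  - split; last by move=> K KA f eK; apply: pdvdB; [apply: (lD i).2 eK|
      apply: pdvd_mull; apply: (lD i0).2 eK].
    split=> [c p q|p q]; last by rewrite (derM _ _ (dD i)) (derM _ _ (dD i0)); ring.
    rewrite (dD i).1 (dD i0).1 mulrDr scalerBr scalerAr.
    by rewrite opprD addrACA.
  - by rewrite rmorphB rmorphM /= chgK ?hyp_sub // (ek i).1 subrr.
apply: (@has_exponentsI _ _ _ D' deg).
- split=> // [E /log_der_addE[/sD[g eg] Ea]|g g0].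
    pose c := g i0 + \sum_(i | i != i0) g i * sigma (k i).
    have [d ed] : pdvd alpha c.
      apply/pdvd_form; apply: (mulIf h0); rewrite mul0r -[RHS]Ea eg (bigD1 i0) //=.
      rewrite !rmorphD !rmorph_sum /= mulrDl !rmorphM /=; congr (_ + _); rewrite mulr_suml.
      by apply: eq_bigr => i _; rewrite !rmorphM /= (chgK (hyp_sub W f0)) (ek i).1 mulrA.
    exists (fun i => if i == i0 then d else g i) => q.
    rewrite eg (bigD1 i0) //= [RHS](bigD1 i0) //= /D' eqxx mulrA -ed /c.
    rewrite mulrDl -addrA; congr (_ + _); rewrite mulr_suml -big_split /=.
    by apply: eq_bigr => i /negPf ->; ring.
  pose g' i := if i == i0 then alpha * g i0 - \sum_(i | i != i0) g i * sigma (k i) else g i.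
  have g'0 : forall i, g' i = 0.
    apply: iD => q; rewrite -[RHS](g0 q) (bigD1 i0) //= [RHS](bigD1 i0) //= /g' /D' !eqxx.
    have eS : (\sum_(i | i != i0) g i * sigma (k i)) * D i0 q =
        \sum_(i | i != i0) g i * sigma (k i) * D i0 q by rewrite mulr_suml.
    rewrite mulrBl eS addrAC -addrA -sumrB mulrA [g i0 * _]mulrC; congr (_ + _).
    by apply: eq_bigr => i /negPf ->; ring.
  have gi i : i != i0 -> g i = 0 by move=> ii0; have := g'0 i; rewrite /g' (negPf ii0).
  move=> i; have [->|/gi //] := eqVneq i i0; have := g'0 i0.
  rewrite /g' eqxx big1 => [|j /gi ->]; last by rewrite mul0r.
  by rewrite subr0 => /eqP; rewrite mulf_eq0 => /orP[/eqP/form_poly_eq0|/eqP].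
- move=> i j; rewrite /D' /deg; case: eqP => _.
    by rewrite -add1n -ei0; apply: dhomogM => //; apply: form_poly_homog.
  apply: rpredB => //; have [_] := ek i; case: ifP => [le_b hk|_ /eqP ->].
    by have := dhomogM (chg_homog W hk) (hD i0 j); rewrite ei0 subnK.
  by rewrite raddf0 mul0r; apply: dhomog0.
- have pi := perm_to_rem (mem_enum predT i0 : i0 \in enum 'I_(size e1)).
  rewrite perm_sym (perm_trans (perm_map deg pi)) //= {1}/deg eqxx perm_cons.
  rewrite -(perm_cons b) perm_sym -(permPl pe) perm_sym.
  have -> : [seq deg i | i <- rem i0 (enum 'I_(size e1))] =
            [seq nth 0%N e1 (val i) | i : 'I_(size e1) <- rem i0 (enum 'I_(size e1))].
    apply/eq_in_map => i; rewrite mem_rem_uniq ?enum_uniq // inE => /andP[/negPf ii0 _].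
    by rewrite /deg ii0.
  have := perm_map (fun i : 'I_(size e1) => nth 0%N e1 i) pi.
  rewrite /= ei0 perm_sym => /perm_trans; apply.
  by rewrite (map_comp (nth 0%N e1) val) val_enum_ord (_ : map _ _ = e1) //; apply: mkseq_nth.
Qed.

End Addition.
End Exponents.

(** * Inductive freeness from systems of equations *)

Section Free.
Variables (R : realType) (V : vectType R).
Implicit Types (W H K X : {vspace V}) (A : {fset {vspace V}}).
Implicit Types (f g : 'Hom(V, R^o)) (P : 'Hom(V, R^o) -> Prop).

Definition free_with W A (e : seq nat) : Prop :=
  [/\ is_arrangement W A, has_exponents W A e, ind_free W A & #|` A| = sumn e].

Lemma free_with_perm W A e e' :
  perm_eq e e' -> free_with W A e -> free_with W A e'.
Proof.
by move=> pe [arrA he iA cA]; split; rewrite // -?(perm_sumn pe) //;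
  apply: has_exponents_perm he.
Qed.

Lemma free_with_empty W : free_with W fset0 (nseq (\dim W) 0%N).
Proof.
split; [by move=> K; rewrite in_fset0 | exact: has_exponents_empty |
  exact: ind_free_empty | by rewrite cardfs0 sumn_nseq mul0n].
Qed.

Lemma restr_hyp W A f0 : is_arrangement W A -> nz_on W f0 -> hyp W f0 \in A ->
  restr A (hyp W f0) = [fset (K :&: hyp W f0)%VS | K in (A `\ hyp W f0)]%fset.
Proof.
move=> arrA nz0 HA; have [_ dH] := arrA _ HA.
have sub K : K \in A -> ((hyp W f0 <= K)%VS = (K == hyp W f0)).
  move=> /arrA[_ dK]; apply/idP/eqP => [s|->]; last exact: subvv.
  by apply/esym/eqP; rewrite eqEdim s -ltnS dK dH leqnn.
apply/fsetP => X; apply/imfsetP/imfsetP => -[K /=].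
  by rewrite !inE => /andP[KA]; rewrite sub // => NK ->; exists K; rewrite // !inE NK KA.
by rewrite !inE => /andP[NK KA] ->; exists K; rewrite // !inE KA sub.
Qed.

Lemma addition W A f0 e1 e2 b : nz_on W f0 -> hyp W f0 \in A ->
  free_with W (A `\ hyp W f0)%fset e1 ->
  free_with (hyp W f0) (restr A (hyp W f0)) e2 -> perm_eq e1 (b :: e2) ->
  free_with W A (b.+1 :: e2).
Proof.
move=> nz0 HA [arr1 he1 i1 c1] [arr2 he2 i2 c2] pe.
have arrA : is_arrangement W A.
  move=> K KA; have [->|NK] := eqVneq K (hyp W f0); first by rewrite hyp_sub dim_hyp.
  by apply: arr1; rewrite !inE NK.
have HN : hyp W f0 \notin (A `\ hyp W f0)%fset by rewrite !inE eqxx.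
split=> //.
- rewrite -(fsetD1K HA); apply: (addition_exponents arr1 nz0 HN he1 _ pe); rewrite -restr_hyp //.
  by rewrite c1 c2 (perm_sumn pe) /= addnC.
- apply: (ind_free_add arrA HA i1 i2 he1 he2) => x.
  by rewrite (seq.permP pe) /= leq_addl.
- by rewrite (cardfsD1 (hyp W f0)) HA c1 (perm_sumn pe).
Qed.

Definition eq_ker W f g : Prop := forall w, w \in W -> (f w == 0) = (g w == 0).

Lemma eq_ker_hyp W f g : eq_ker W f g -> hyp W f = hyp W g.
Proof.
move=> e; apply/vspaceP => w; rewrite !mem_hyp.
by have [wW|] := boolP (w \in W); rewrite ?andbF // e.
Qed.

Lemma eq_ker_nz W f g : eq_ker W f g -> nz_on W g -> nz_on W f.
Proof. by move=> e [w wW gw]; exists w; rewrite // e. Qed.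

Definition equations W A P : Prop :=
  forall K, K \in A <-> exists2 f, P f & K = hyp W f.

Definition refines W P P' : Prop :=
  forall f, P f -> exists2 g, P' g & eq_ker W f g.

Lemma refines_sub W P P' : (forall f, P f -> P' f) -> refines W P P'.
Proof. by move=> s f /s Pf; exists f. Qed.

Lemma equations_eq W A P P' :
  refines W P P' -> refines W P' P -> equations W A P -> equations W A P'.
Proof.
move=> PP' P'P eA K; rewrite eA; split=> -[f].
  by move=> /PP'[g Pg /eq_ker_hyp ->] ->; exists g.
by move=> /P'P[g Pg /eq_ker_hyp ->] ->; exists g.
Qed.

Lemma equations_restr W A P P' f0 : is_arrangement W A ->
  equations W A P -> nz_on W f0 ->
  (forall f, P f -> (forall w, w \in hyp W f0 -> f w = 0) \/
     exists2 g, P' g & eq_ker (hyp W f0) f g) ->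
  refines (hyp W f0) P' P -> (forall g, P' g -> nz_on (hyp W f0) g) ->
  equations (hyp W f0) (restr A (hyp W f0)) P'.
Proof.
move=> arrA eA nz0 PP' P'P nzP'.
have cap f : (hyp W f :&: hyp W f0)%VS = hyp (hyp W f0) f.
  by rewrite /hyp -!capvA; congr (_ :&: _)%VS; rewrite [(W :&: _)%VS]capvC -capvA capvv.
move=> X; split=> [/imfsetP[K /=]|[g Pg ->]].
  rewrite !inE => /andP[/eA[f Pf ->] s] ->; rewrite cap.
  have [f_0|[g Pg /eq_ker_hyp ->]] := PP' f Pf; last by exists g.
  case/negP: s; apply/subvP => w wH; rewrite mem_hyp f_0 // eqxx.
  exact: subvP (hyp_sub _ _) _ wH.
have [f Pf e] := P'P g Pg; apply/imfsetP; exists (hyp W f) => /=.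
  rewrite !inE; apply/andP; split; first by apply/eA; exists f.
  have [w wH gw] := nzP' g Pg; apply/subvPn; exists w => //.
  by rewrite mem_hyp -e // (negPf gw).
by rewrite cap; apply: eq_ker_hyp.
Qed.

Lemma addition_equations W A P P1 P2 f0 e1 e2 b e :
  equations W A P -> nz_on W f0 -> (forall f, P f <-> P1 f \/ f = f0) ->
  (forall g, P2 g -> nz_on (hyp W f0) g) ->
  refines (hyp W f0) P1 P2 -> refines (hyp W f0) P2 P1 ->
  (forall A', equations W A' P1 -> free_with W A' e1) ->
  (forall A', equations (hyp W f0) A' P2 -> free_with (hyp W f0) A' e2) ->
  perm_eq e1 (b :: e2) -> perm_eq (b.+1 :: e2) e -> free_with W A e.
Proof.
move=> eA nz0 PP1 nz2 P12 P21 F1 F2 pe1 pe; apply: (free_with_perm pe).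
have HA : hyp W f0 \in A by apply/eA; exists f0 => //; apply/PP1; right.
have free1 : free_with W (A `\ hyp W f0)%fset e1.
  apply: F1 => K; rewrite !inE; split=> [/andP[NK /eA[f /PP1[P1f|->] eK]]|[f P1f ->]].
  - by exists f.
  - by rewrite eK eqxx in NK.
  apply/andP; split; last by apply/eA; exists f => //; apply/PP1; left.
  have [g /nz2 nzg /eq_ker_nz] := P12 f P1f.
  move=> /(_ nzg)[w wH fw]; apply/eqP => eH; move: wH; rewrite -eH mem_hyp.
  by rewrite (negPf fw).
have [arr1 _ _ _] := free1.
have arrA : is_arrangement W A.
  move=> K KA; have [->|NK] := eqVneq K (hyp W f0); first by rewrite hyp_sub dim_hyp.
  by apply: arr1; rewrite !inE NK.
apply: (addition nz0 HA free1) pe1; apply: F2.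
apply: (equations_restr arrA eA nz0) => //.
  move=> f /PP1[/P12|->]; first by right.
  by left=> w; rewrite mem_hyp => /andP[/eqP].
by move=> g /P21[f P1f e']; exists f => //; apply/PP1; left.
Qed.

Definition flagged W A (e : seq nat) : Prop :=
  exists X : nat -> {vspace V},
      [/\ X (\dim W) = W,
          forall i, (1 <= i < \dim W)%N -> (X i <= X i.+1)%VS
        & forall i, (1 <= i <= \dim W)%N ->
          [/\ in_lattice W A (X i), \dim (X i) = i,
              ind_free (X i) (restr A (X i))
            & has_exponents (X i) (restr A (X i)) (take i e)]].

Lemma memv_bigcap (s : seq {vspace V}) v :
  (v \in (\bigcap_(K <- s) K)%VS) = all (fun K => v \in K) s.
Proof.
by elim: s => [|K s ih]; rewrite ?big_nil ?memvf // big_cons memv_cap ih.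
Qed.

Lemma in_lattice_full W A : in_lattice W A W.
Proof. by exists fset0; rewrite ?fsub0set // big_nil capvf. Qed.

Lemma restr_full W A : is_arrangement W A -> restr A W = A.
Proof.
move=> arrA; have N K : K \in A -> ~~ (W <= K)%VS.
  by move=> /arrA[_ dK]; apply/negP => /dimvS; rewrite -dK ltnn.
apply/fsetP => K; apply/imfsetP/idP => [[K' /=]|KA].
  by rewrite !inE => /andP[KA _] ->; have [/capv_idPl -> _] := arrA _ KA.
exists K; rewrite /= ?inE ?KA ?N //.
by have [/capv_idPl -> _] := arrA _ KA.
Qed.

Lemma restr_restr A H X : (X <= H)%VS -> restr (restr A H) X = restr A X.
Proof.
move=> sXH; apply/fsetP => Y; apply/imfsetP/imfsetP => -[K /=]; rewrite !inE.
  move=> /andP[/imfsetP[K' /=]]; rewrite !inE => /andP[K'A _] -> + ->.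
  rewrite subv_cap sXH andbT => N; exists K'; rewrite /= ?inE ?K'A //.
  by rewrite -capvA; congr (_ :&: _)%VS; apply/capv_idPr.
move=> /andP[KA N] ->; exists (K :&: H)%VS.
  rewrite /= !inE subv_cap sXH andbT N andbT; apply/imfsetP; exists K => //=.
  by rewrite !inE KA; apply: contra N; apply: subv_trans.
by rewrite /= -capvA; congr (_ :&: _)%VS; apply/esym/capv_idPr.
Qed.

Lemma in_lattice_restr W A H X : (H <= W)%VS -> H \in A ->
  in_lattice H (restr A H) X -> in_lattice W A X.
Proof.
move=> sHW HA [B /fsubsetP sB eX]; exists [fset K in A | (X <= K)%VS]%fset.
  by apply/fsubsetP => K; rewrite !inE => /andP[].
have sXH : (X <= H)%VS by rewrite eX; exact: capvSl.
apply/eqP; rewrite eqEsubv; apply/andP; split; apply/subvP => w.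
  move=> wX; rewrite memv_cap memv_bigcap (subvP (subv_trans sXH sHW)) //=.
  by apply/allP => K; rewrite !inE => /andP[_ /subvP]; apply.
rewrite memv_cap memv_bigcap => /andP[wW /allP wB].
have wH : w \in H by apply: wB; rewrite !inE HA.
rewrite eX memv_cap memv_bigcap wH /=; apply/allP => K' K'B.
have /imfsetP[K /=] := sB _ K'B; rewrite !inE => /andP[KA _] eK'.
rewrite eK' memv_cap wH andbT; apply: wB; rewrite !inE KA eX /=.
apply/subvP => v; rewrite memv_cap memv_bigcap => /andP[_ /allP/(_ _ K'B)].
by rewrite eK' memv_cap => /andP[].
Qed.

Lemma flagged_line W A e : \dim W = 1 -> size e = 1 -> free_with W A e -> flagged W A e.
Proof.
move=> dW se [arrA he iA _]; exists (fun=> W); split=> // i.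
rewrite dW -eqn_leq => /eqP <-; rewrite restr_full // take_oversize ?se //.
by split; first exact: in_lattice_full.
Qed.

Lemma flagged_step W A f0 e e' : nz_on W f0 -> hyp W f0 \in A ->
  size e = \dim W -> free_with W A e -> e' = take (\dim (hyp W f0)) e ->
  flagged (hyp W f0) (restr A (hyp W f0)) e' -> flagged W A e.
Proof.
move=> nz0 HA se [arrA he iA _] -> [X [XH Xmon Xflag]].
have dH := dim_hyp nz0.
have sX i : (1 <= i <= \dim (hyp W f0))%N -> (X i <= hyp W f0)%VS.
  by move=> /Xflag[[B _ ->] _ _ _]; apply: capvSl.
exists (fun i => if i == \dim W then W else X i); split; first by rewrite eqxx.
  move=> i /andP[i1 iW]; rewrite (ltn_eqF iW); case: eqP => [ei|/eqP ni].
    apply: subv_trans (hyp_sub W f0); apply: sX; rewrite i1 /=.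
    by rewrite -ltnS dH -ei.
  by apply: Xmon; rewrite i1 -ltnS dH ltn_neqAle ni.
move=> i /andP[i1]; rewrite leq_eqVlt => /orP[/eqP ->|iW].
  by rewrite eqxx restr_full // -se take_size; split=> //; apply: in_lattice_full.
rewrite (ltn_eqF iW); have iH : (1 <= i <= \dim (hyp W f0))%N by rewrite i1 -ltnS dH.
have [Xl Xd Xi Xe] := Xflag i iH; rewrite (restr_restr _ (sX i iH)) in Xi Xe.
split=> //; first by apply: in_lattice_restr Xl; rewrite ?hyp_sub.
by move: Xe; rewrite take_takel //; case/andP: iH.
Qed.

End Free.

(** * Restrictions of Shi arrangements *)

Section Shi.
Variables (R : realType) (V : vectType R).
Implicit Types (W H K X : {vspace V}) (A : {fset {vspace V}}).
Implicit Types (f g z : 'Hom(V, R^o)) (x : nat -> 'Hom(V, R^o)).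
Implicit Types (lo : nat -> int) (a b s : int).

Lemma eval_scaleE (c : R) f v : (c *: f) v = c * f v :> R.
Proof. by rewrite scale_lfunE. Qed.

Definition evalE := (add_lfunE, opp_lfunE, eval_scaleE).

Lemma eq_ker_scale W f g (c : R) : c != 0 ->
  (forall w, w \in W -> f w = c * g w :> R) -> eq_ker W f g.
Proof. by move=> c0 e w /e ->; rewrite mulf_eq0 (negPf c0). Qed.

Lemma eq_ker_same W f g :
  (forall w, w \in W -> f w = g w :> R) -> eq_ker W f g.
Proof. by move=> e w /e ->. Qed.

Lemma eq_ker_opp W f g :
  (forall w, w \in W -> f w = - g w :> R) -> eq_ker W f g.
Proof. by move=> e w /e ->; rewrite oppr_eq0. Qed.

Lemma eq_ker_hom W x z i s t : s != t ->
  (forall w, w \in W -> x i w = t%:~R * z w :> R) ->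
  eq_ker W (x i - s%:~R *: z) z.
Proof.
move=> st e; apply: (@eq_ker_scale _ _ _ (t - s)%:~R).
  by rewrite intr_eq0 subr_eq0 eq_sym.
by move=> w /e; rewrite !evalE => ->; rewrite intrB mulrBl.
Qed.

(* Writing z for the homogenizing coordinate, the hyperplanes x_i = x_j for
   i < j < n, x_i = x_j + 1 for i < j < q and x_i = s for lo i <= s <= b. *)
Inductive shi_form (q n : nat) lo b z x : 'Hom(V, R^o) -> Prop :=
| ShiZ : shi_form q n lo b z x z
| ShiD i j of (i < j < n)%N : shi_form q n lo b z x (x i - x j)
| ShiS i j of (i < j < q)%N : shi_form q n lo b z x (x i - x j - z)
| ShiP i s of (i < n)%N & lo i <= s <= b :
    shi_form q n lo b z x (x i - s%:~R *: z).

Lemma shi_form_ext q n lo lo' b z x f :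
  (forall i, (i < n)%N -> lo i = lo' i) ->
  shi_form q n lo b z x f -> shi_form q n lo' b z x f.
Proof.
move=> e [|i j ij|i j ij|i s i_n]; [exact: ShiZ|exact: ShiD|exact: ShiS|].
by rewrite e // => hs; apply: ShiP.
Qed.

Lemma equations_shi_ext W A q n lo lo' b z x :
  (forall i, (i < n)%N -> lo i = lo' i) ->
  equations W A (shi_form q n lo b z x) -> equations W A (shi_form q n lo' b z x).
Proof.
by move=> e; apply: equations_eq; apply: refines_sub => f; apply: shi_form_ext => i /e.
Qed.

(* Linear independence of z, x_0, .., x_(n-1) on W, stated as surjectivity of
   the map W -> R^(n+1) which they define. *)
Definition indep n x z W : Prop := forall (v : nat -> R) (c : R),
  exists w, [/\ w \in W, z w = c & forall i, (i < n)%N -> x i w = v i].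

Lemma indep_form_nz q n lo b z x W f : indep n x z W -> (q <= n)%N ->
  shi_form q n lo b z x f -> nz_on W f.
Proof.
move=> ind qn; have [w [wW zw xw]] := ind (fun i => (i.+2)%:R^-1) 1.
have bnd i : 0 < ((i.+2)%:R^-1 : R) < 1.
  by rewrite invr_gt0 ltr0n invf_lt1 ?ltr0n // ltr1n.
have sep i j : (i < j)%N -> (i.+2)%:R^-1 - (j.+2)%:R^-1 != 0 :> R.
  by move=> ij; rewrite subr_eq0 (inj_eq invr_inj) eqr_nat; lia.
move=> Pf; exists w => //; case: Pf => [|i j ij|i j ij|i s i_n _].
- by rewrite zw oner_eq0.
- by rewrite !evalE !xw ?sep; lia.
- rewrite !evalE !xw ?zw; try lia.
  have H (u v : R) : 0 < u < 1 -> 0 < v < 1 -> u - v - 1 <> 0 by lra.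
  by apply/eqP; apply: H (bnd i) (bnd j).
- rewrite !evalE xw // zw mulr1 subr_eq0; apply/eqP => e; have := bnd i.
  by rewrite e ltr0z ltrz1; lia.
Qed.

Lemma indep_dim n x z W : indep n x z W -> (n < \dim W)%N.
Proof.
elim: n W => [|n ih] W ind.
  have [w [wW zw _]] := ind (fun=> 0) 1; rewrite lt0n dimv_eq0.
  apply/eqP => W0; move: wW; rewrite W0 memv0 => /eqP w0; move: zw.
  by rewrite w0 linear0 => /esym/eqP; rewrite oner_eq0.
have nzx : nz_on W (x n).
  have [w [wW _ xw]] := ind (fun=> 1) 1; exists w => //.
  by rewrite xw // oner_eq0.
rewrite -(dim_hyp nzx) ltnS; apply: ih => v c.
have [w [wW zw xw]] := ind (fun i => if i == n then 0 else v i) c.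
exists w; split=> // [|i i_n]; first by rewrite mem_hyp wW xw // eqxx eqxx.
by rewrite xw ?(ltn_eqF i_n) // ltnW.
Qed.

Definition shi_lo a (p : nat) (i : nat) : int := a + (i < p)%N.

Lemma shi_form_split q p a b z x f : (p < q)%N -> a <= b ->
  shi_form q q (shi_lo a p) b z x f <->
  shi_form q q (shi_lo a p.+1) b z x f \/ f = x p - a%:~R *: z.
Proof.
move=> pq ab; split.
  case=> [|i j ij|i j ij|i s i_q hs]; first by left; apply: ShiZ.
  - by left; apply: ShiD.
  - by left; apply: ShiS.
  have [/andP[/eqP -> /eqP ->]|N] := boolP ((i == p) && (s == a)); first by right.
  by left; apply: ShiP => //; move: N hs; rewrite /shi_lo; lia.
case=> [|->]; last by apply: ShiP; rewrite ?pq // /shi_lo ltnn addr0 lexx.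
case=> [|i j ij|i j ij|i s i_q hs]; [exact: ShiZ|exact: ShiD|exact: ShiS|].
by apply: ShiP => //; move: hs; rewrite /shi_lo; lia.
Qed.

Lemma hyp_value W z x p (a : int) w : w \in hyp W (x p - a%:~R *: z) ->
  x p w = a%:~R * z w :> R.
Proof. by rewrite mem_hyp !evalE subr_eq0 => /andP[/eqP]. Qed.

Lemma shift_nz n W z x p (a : int) : (p < n)%N -> indep n x z W ->
  nz_on W (x p - a%:~R *: z).
Proof.
move=> pn ind; have [w [wW zw xw]] := ind (fun=> 1) 0; exists w => //.
by rewrite !evalE xw // zw mulr0 subr0 oner_eq0.
Qed.

Definition skip x (p i : nat) := if (i < p)%N then x i else x i.+1.

Lemma skip_lt x p i : (i < p)%N -> skip x p i = x i.
Proof. by rewrite /skip => ->. Qed.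

Lemma skip_gt x p i : (p < i)%N -> skip x p i.-1 = x i.
Proof. by case: i => // i; rewrite ltnS /skip ltnNge => ->. Qed.

Lemma indep_hyp q W z x p (a : int) : (p < q.+1)%N -> indep q.+1 x z W ->
  indep q (skip x p) z (hyp W (x p - a%:~R *: z)).
Proof.
move=> pq ind v c.
have [w [wW zw xw]] := ind (fun i => if i == p then a%:~R * c else
  if (i < p)%N then v i else v i.-1) c.
exists w; split=> // [|i iq].
  by rewrite mem_hyp wW andbT !evalE zw xw // eqxx subrr.
rewrite /skip; case: ltnP => ip; rewrite xw; try lia.
  by rewrite (ltn_eqF ip) ip.
by rewrite gtn_eqF ?ltnS // ltnNge leqW.
Qed.

Lemma shi_restr q N p a W z x : (0 < N)%N -> (p < q.+1)%N ->
  let H := hyp W (x p - a%:~R *: z) in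
  let P := shi_form q.+1 q.+1 (shi_lo a p.+1) (a + N%:Z) z x in
  let P' := shi_form q q (shi_lo (a - 1) p) (a + N%:Z) z (skip x p) in
  refines H P P' /\ refines H P' P.
Proof.
move=> N0 pq H P P'; have hv := @hyp_value W z x p a.
have lt_x i : (i < p)%N -> x i = skip x p i by move=> /skip_lt ->.
have gt_x i : (p < i)%N -> x i = skip x p i.-1 by move=> /skip_gt ->.
split=> f.
  case=> [|i j ij|i j ij|i s i_q hs]; first by exists z => //; apply: ShiZ.
  - have [ip|pi|ip] := ltngtP i p; have [jp|pj|jp] := ltngtP j p; try lia;
      try subst i; try subst j.
    + by exists (x i - x j) => //; rewrite !lt_x //; apply: ShiD; lia.
    + by exists (x i - x j) => //; rewrite lt_x // gt_x //; apply: ShiD; lia.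
    + exists (x i - a%:~R *: z).
        by rewrite lt_x //; apply: ShiP; rewrite /shi_lo; lia.
      by apply: eq_ker_same => w /hv; rewrite !evalE => ->.
    + by exists (x i - x j) => //; rewrite !gt_x //; apply: ShiD; lia.
    + exists (x j - a%:~R *: z).
        by rewrite gt_x //; apply: ShiP; rewrite /shi_lo; lia.
      by apply: eq_ker_opp => w /hv; rewrite !evalE => ->; ring.
  - have [ip|pi|ip] := ltngtP i p; have [jp|pj|jp] := ltngtP j p; try lia;
      try subst i; try subst j.
    + by exists (x i - x j - z) => //; rewrite !lt_x //; apply: ShiS; lia.
    + by exists (x i - x j - z) => //; rewrite lt_x // gt_x //; apply: ShiS; lia.
    + exists (x i - (a + 1)%:~R *: z).
        by rewrite lt_x //; apply: ShiP; rewrite /shi_lo; lia.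
      by apply: eq_ker_same => w /hv; rewrite !evalE => ->; ring.
    + by exists (x i - x j - z) => //; rewrite !gt_x //; apply: ShiS; lia.
    + exists (x j - (a - 1)%:~R *: z).
        by rewrite gt_x //; apply: ShiP; rewrite /shi_lo; lia.
      by apply: eq_ker_opp => w /hv; rewrite !evalE => ->; ring.
  - have [ip|pi|ip] := ltngtP i p.
    + exists (x i - s%:~R *: z) => //; rewrite lt_x //.
      by apply: ShiP; move: hs; rewrite /shi_lo; lia.
    + exists (x i - s%:~R *: z) => //; rewrite gt_x //.
      by apply: ShiP; move: hs; rewrite /shi_lo; lia.
    + exists z; first exact: ShiZ; apply: eq_ker_hom; last by rewrite ip; exact: hv.
      by move: hs; rewrite /shi_lo ip; lia.
case=> [|i j ij|i j ij|i s i_q hs]; first by exists z => //; apply: ShiZ.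
- exists (skip x p i - skip x p j) => //; rewrite /skip.
  by case: ltnP => ip; case: ltnP => jp; apply: ShiD; lia.
- exists (skip x p i - skip x p j - z) => //; rewrite /skip.
  by case: ltnP => ip; case: ltnP => jp; apply: ShiS; lia.
- have [ip|pi] := ltnP i p.
    rewrite skip_lt //; have [sa|sa] := eqVneq s a.
      exists (x i - x p); first by apply: ShiD; lia.
      by apply: eq_ker_same => w /hv; rewrite sa !evalE => ->.
    exists (x i - s%:~R *: z) => //.
    by apply: ShiP; move: hs sa; rewrite /shi_lo; lia.
  rewrite -[i]/(i.+1.-1) skip_gt ?ltnS //; have [sa|sa] := eqVneq s (a - 1).
    exists (x p - x i.+1 - z); first by apply: ShiS; lia.
    by apply: eq_ker_opp => w /hv; rewrite sa !evalE => ->; ring.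
  exists (x i.+1 - s%:~R *: z) => //.
  by apply: ShiP; move: hs sa; rewrite /shi_lo; lia.
Qed.

(* The vertices after p, translated by 1, become the first ones. *)
Definition turn q p x z (i : nat) :=
  if (i < q - p)%N then x (p + i).+1 + z else x (i - (q - p))%N.

Lemma turn_gt q p x z i : (p < i <= q)%N -> turn q p x z (i - p.+1) = x i + z.
Proof.
move=> ip; rewrite /turn ifT; last by lia.
by congr (x _ + z); lia.
Qed.

Lemma turn_lt q p x z i : (i < p)%N -> turn q p x z (i + (q - p)) = x i.
Proof. by move=> ip; rewrite /turn ifF ?addnK //; lia. Qed.

Lemma indep_turn q W z x p (a : int) : (p < q.+1)%N -> indep q.+1 x z W ->
  indep q (turn q p x z) z (hyp W (x p - a%:~R *: z)).
Proof.
move=> pq ind v c.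
have [w [wW zw xw]] := ind (fun i => if i == p then a%:~R * c else
  if (i < p)%N then v (i + (q - p))%N else v (i - p.+1)%N - c) c.
exists w; split=> // [|i iq].
  by rewrite mem_hyp wW andbT !evalE zw xw // eqxx subrr.
rewrite /turn; case: ltnP => ip; rewrite ?evalE xw; try lia.
  rewrite ifF; last by lia.
  rewrite ifF; last by lia.
  by rewrite zw subrK; congr v; lia.
rewrite ifF; last by lia.
rewrite ifT; last by lia.
by congr v; lia.
Qed.

Lemma shi_restr_turn q p a W z x : (p < q.+1)%N ->
  let H := hyp W (x p - a%:~R *: z) in
  let P := shi_form q.+1 q.+1 (shi_lo a p.+1) a z x in
  let P' := shi_form q q (shi_lo a 0) (a + 1%:Z) z (turn q p x z) in
  refines H P P' /\ refines H P' P.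
Proof.
move=> pq H P P'; have hv := @hyp_value W z x p a.
have T i : (p < i <= q)%N -> x i = turn q p x z (i - p.+1) - z.
  by move=> ip; rewrite turn_gt // addrK.
have L i : (i < p)%N -> x i = turn q p x z (i + (q - p)).
  by move=> ip; rewrite turn_lt.
split=> f.
  case=> [|i j ij|i j ij|i s i_q hs]; first by exists z => //; apply: ShiZ.
  - have [ip|pi|ip] := ltngtP i p; have [jp|pj|jp] := ltngtP j p; try lia;
      try subst i; try subst j.
    + by exists (x i - x j) => //; rewrite !L //; apply: ShiD; lia.
    + exists (turn q p x z (j - p.+1) - turn q p x z (i + (q - p)) - z).
        by apply: ShiS; lia.
      by rewrite -L // turn_gt; [apply: eq_ker_opp => w _; rewrite !evalE; ring|lia].
    + exists (turn q p x z (i + (q - p)) - a%:~R *: z).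
        by apply: ShiP; rewrite /shi_lo; lia.
      by rewrite -L //; apply: eq_ker_same => w /hv; rewrite !evalE => ->.
    + exists (turn q p x z (i - p.+1) - turn q p x z (j - p.+1)).
        by apply: ShiD; lia.
      by rewrite !turn_gt; [apply: eq_ker_same => w _; rewrite !evalE; ring|lia|lia].
    + exists (turn q p x z (j - p.+1) - (a + 1)%:~R *: z).
        by apply: ShiP; rewrite /shi_lo; lia.
      by rewrite turn_gt; [apply: eq_ker_opp => w /hv; rewrite !evalE => ->; ring|lia].
  - have [ip|pi|ip] := ltngtP i p; have [jp|pj|jp] := ltngtP j p; try lia;
      try subst i; try subst j.
    + by exists (x i - x j - z) => //; rewrite !L //; apply: ShiS; lia.
    + exists (turn q p x z (j - p.+1) - turn q p x z (i + (q - p))).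
        by apply: ShiD; lia.
      by rewrite -L // turn_gt; [apply: eq_ker_opp => w _; rewrite !evalE; ring|lia].
    + exists (turn q p x z (i + (q - p)) - (a + 1)%:~R *: z).
        by apply: ShiP; rewrite /shi_lo; lia.
      by rewrite -L //; apply: eq_ker_same => w /hv; rewrite !evalE => ->; ring.
    + exists (turn q p x z (i - p.+1) - turn q p x z (j - p.+1) - z).
        by apply: ShiS; lia.
      by rewrite !turn_gt; [apply: eq_ker_same => w _; rewrite !evalE; ring|lia|lia].
    + exists (turn q p x z (j - p.+1) - a%:~R *: z).
        by apply: ShiP; rewrite /shi_lo; lia.
      by rewrite turn_gt; [apply: eq_ker_opp => w /hv; rewrite !evalE => ->; ring|lia].
  - have pi : (p < i)%N by move: hs; rewrite /shi_lo; lia.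
    have -> : s = a by move: hs; rewrite /shi_lo; lia.
    exists (turn q p x z (i - p.+1) - (a + 1)%:~R *: z).
      by apply: ShiP; rewrite /shi_lo; lia.
    by rewrite turn_gt; [apply: eq_ker_same => w _; rewrite !evalE; ring|lia].
case=> [|i j ij|i j ij|i s i_q hs]; first by exists z => //; apply: ShiZ.
- rewrite /turn; case: ltnP => ip; case: ltnP => jp; try lia.
  + exists (x (p + i).+1 - x (p + j).+1); first by apply: ShiD; lia.
    by apply: eq_ker_same => w _; rewrite !evalE; ring.
  + exists (x (j - (q - p))%N - x (p + i).+1 - z); first by apply: ShiS; lia.
    by apply: eq_ker_opp => w _; rewrite !evalE; ring.
  + by exists (x (i - (q - p))%N - x (j - (q - p))%N) => //; apply: ShiD; lia.
- rewrite /turn; case: ltnP => ip; case: ltnP => jp; try lia.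
  + exists (x (p + i).+1 - x (p + j).+1 - z); first by apply: ShiS; lia.
    by apply: eq_ker_same => w _; rewrite !evalE; ring.
  + exists (x (j - (q - p))%N - x (p + i).+1); first by apply: ShiD; lia.
    by apply: eq_ker_opp => w _; rewrite !evalE; ring.
  + by exists (x (i - (q - p))%N - x (j - (q - p))%N - z) => //; apply: ShiS; lia.
- have [->|->] : s = a \/ s = a + 1 by move: hs; rewrite /shi_lo; lia.
    rewrite /turn; case: ltnP => ip.
      exists (x p - x (p + i).+1 - z); first by apply: ShiS; lia.
      by apply: eq_ker_opp => w /hv; rewrite !evalE => ->; ring.
    exists (x (i - (q - p))%N - x p); first by apply: ShiD; lia.
    by apply: eq_ker_same => w /hv; rewrite !evalE => ->.
  rewrite /turn; case: ltnP => ip.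
    exists (x p - x (p + i).+1); first by apply: ShiD; lia.
    by apply: eq_ker_opp => w /hv; rewrite !evalE => ->; ring.
  exists (x (i - (q - p))%N - x p - z); first by apply: ShiS; lia.
  by apply: eq_ker_same => w /hv; rewrite !evalE => ->; ring.
Qed.

Lemma shi_origin q a W z x :
  let P := shi_form q.+1 q.+1 (shi_lo a q.+1) a z x in
  let P' := shi_form q q (shi_lo 0 0) (0 + 1%:Z) z (fun i => x i - x q) in
  refines W P P' /\ refines W P' P.
Proof.
split=> f.
  case=> [|i j ij|i j ij|i s i_q hs]; first by exists z => //; apply: ShiZ.
  - have [jq|->] : (j < q)%N \/ j = q by lia.
      exists ((x i - x q) - (x j - x q)).
        by apply: (ShiD _ _ _ _ (fun i => x i - x q)); lia.
      by apply: eq_ker_same => w _; rewrite !evalE; ring.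
    exists ((x i - x q) - 0%:~R *: z).
      by apply: (ShiP _ _ (fun i => x i - x q)); rewrite /shi_lo; lia.
    by apply: eq_ker_same => w _; rewrite !evalE; ring.
  - have [jq|->] : (j < q)%N \/ j = q by lia.
      exists ((x i - x q) - (x j - x q) - z).
        by apply: (ShiS _ _ _ _ (fun i => x i - x q)); lia.
      by apply: eq_ker_same => w _; rewrite !evalE; ring.
    exists ((x i - x q) - 1%:~R *: z).
      by apply: (ShiP _ _ (fun i => x i - x q)); rewrite /shi_lo; lia.
    by apply: eq_ker_same => w _; rewrite !evalE; ring.
  - by move: hs; rewrite /shi_lo; lia.
case=> [|i j ij|i j ij|i s i_q hs]; first by exists z => //; apply: ShiZ.
- exists (x i - x j); first by apply: ShiD; lia.
  by apply: eq_ker_same => w _; rewrite !evalE; ring.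
- exists (x i - x j - z); first by apply: ShiS; lia.
  by apply: eq_ker_same => w _; rewrite !evalE; ring.
- have [->|->] : s = 0 \/ s = 1 by move: hs; rewrite /shi_lo; lia.
    exists (x i - x q); first by apply: ShiD; lia.
    by apply: eq_ker_same => w _; rewrite !evalE; ring.
  exists (x i - x q - z); first by apply: ShiS; lia.
  by apply: eq_ker_same => w _; rewrite !evalE; ring.
Qed.

Lemma indep_origin q x z W : indep q.+1 x z W -> indep q (fun i => x i - x q) z W.
Proof.
move=> ind v c; have [w [wW zw xw]] := ind (fun i => if i == q then 0 else v i) c.
exists w; split=> // i iq; rewrite !evalE !xw; try lia.
by rewrite eqxx (ltn_eqF iq) subr0.
Qed.

End Shi.

(** * Freeness of Shi arrangements and of their fibrations *)

Ltac perm_count :=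
  apply/seq.permP => ?; do ?[rewrite count_cat | rewrite count_nseq | progress rewrite /=]; lia.

Section ShiFree.
Variables (R : realType) (V : vectType R).
Implicit Types (W H K X : {vspace V}) (A : {fset {vspace V}}).
Implicit Types (f g z : 'Hom(V, R^o)) (x : nat -> 'Hom(V, R^o)).
Implicit Types (lo : nat -> int) (a b s : int).

Definition shi_free q : Prop :=
  forall N p a W A x z, (0 < N)%N -> (p <= q)%N -> indep q x z W ->
  equations W A (shi_form q q (shi_lo a p) (a + N%:Z) z x) ->
  free_with W A
    (1%N :: nseq p (q + N).-1 ++ nseq (q - p) (q + N)%N ++ nseq (\dim W - q.+1) 0%N).

(* Here x_i = s is imposed for i >= p and s = a only: the range of values is
   empty for i < p. *)
Lemma shi_free_start q p a W A x z : shi_free q -> (p <= q.+1)%N ->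
  indep q.+1 x z W ->
  equations W A (shi_form q.+1 q.+1 (shi_lo a p) a z x) ->
  free_with W A
    (1%N :: (q.+1 - p)%N :: nseq q q.+1 ++ nseq (\dim W - q.+2) 0%N).
Proof.
move=> Fq; move ej: (q.+1 - p)%N => j; elim: j p A ej => [|j ih] p A ej pq ind eA.
  have dW := indep_dim ind.
  have epq : p = q.+1 by lia.
  rewrite epq in eA.
  have [r1 r2] := shi_origin q a W z x.
  have := Fq 1%N 0%N 0 W A _ z isT isT (indep_origin ind) (equations_eq r1 r2 eA).
  apply: free_with_perm; rewrite /= addn1 subn0 perm_cons.
  by rewrite -(subnSK dW) /=; perm_count.
have pq' : (p < q.+1)%N by lia.
have [r1 r2] := shi_restr_turn a W z x pq'.
have ind' := @indep_turn _ _ q W z x p a pq' ind.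
have nz0 := shift_nz a pq' ind; have dH := dim_hyp nz0.
apply: (@addition_equations _ _ W A _ _ _ _ _ _ j _ eA nz0 _ _ r1 r2
  (fun A' => ih p.+1 A' _ _ ind) (fun A' => Fq 1%N 0%N a _ A' _ z isT isT ind')).
- by move=> f; apply: shi_form_split.
- by move=> g; apply: indep_form_nz ind' _.
- lia.
- lia.
- by rewrite /= addn1 subn0 -dH subSS; perm_count.
- by rewrite /= addn1 subn0 -dH subSS; perm_count.
Qed.

Lemma shi_freeS q : shi_free q -> shi_free q.+1.
Proof.
move=> Fq N p a W A x z N0; elim: N N0 p a A => // N ihN _ p a A.
move ej: (q.+1 - p)%N => j; elim: j p A ej => [|j ih] p A ej pq ind eA.
  have epq : p = q.+1 by lia.
  rewrite epq in eA *.
  have {}eA : equations W A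
      (shi_form q.+1 q.+1 (shi_lo (a + 1) 0) (a + 1 + N%:Z) z x).
    have -> : a + 1 + N%:Z = a + N.+1%:Z by lia.
    by apply: equations_shi_ext eA => i iq; rewrite /shi_lo; lia.
  case: N ihN eA => [_ eA|N ihN eA].
    rewrite addr0 in eA.
    have := shi_free_start Fq (leq0n _) ind eA.
    by rewrite subn0 addn1.
  have := ihN isT 0%N _ A (leq0n _) ind eA.
  by rewrite subn0 [in X in _ -> X]addnS.
have pq' : (p < q.+1)%N by lia.
have [r1 r2] := @shi_restr _ _ q N.+1 p a W z x isT pq'.
have ind' := @indep_hyp _ _ q W z x p a pq' ind.
have nz0 := shift_nz a pq' ind; have dH := dim_hyp nz0.
have eb : a + N.+1%:Z = a - 1 + N.+2%:Z by lia.
rewrite eb in r1 r2 eA.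
apply: (@addition_equations _ _ W A _ _ _ _ _ _ (q.+1 + N)%N _ eA nz0 _ _ r1 r2
  _ (fun A' => Fq N.+2 p (a - 1) _ A' _ z isT _ ind')).
- by move=> f; apply: shi_form_split; lia.
- by move=> g; apply: indep_form_nz ind' _.
- move=> A' eA'; apply: (ih p.+1 A') => //; first by lia.
  by rewrite eb.
- lia.
- rewrite -dH subSS !addnS /= addSn.
  have -> : j = (q - p)%N by lia.
  by perm_count.
- rewrite -dH subSS !addnS /= addSn.
  have -> : j = (q - p)%N by lia.
  by perm_count.
Qed.

Lemma shi_free0 : shi_free 0.
Proof.
move=> N p a W A x z _; rewrite leqn0 => /eqP -> ind eA.
have nzz : nz_on W z.
  by have [w [wW zw _]] := ind (fun=> 0) 1; exists w; rewrite // zw oner_eq0.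
have dH := dim_hyp nzz.
have F A' W' : equations W' A' (fun=> False) -> free_with W' A' (nseq (\dim W') 0%N).
  move=> e; suff -> : A' = fset0 by apply: free_with_empty.
  by apply/fsetP => K; rewrite in_fset0; apply/negP => /e[].
apply: (@addition_equations _ _ W A _ _ _ _ _ _ 0%N _ eA nzz _ _ _ _
  (fun A' => @F A' W) (fun A' => @F A' _)) => //.
- move=> f; split=> [|[//|->]]; last exact: ShiZ.
  by case=> [|i j|i j|i s //]; [right|lia|lia].
- by rewrite -dH.
- by rewrite -dH /= subn1.
Qed.

Lemma shi_freeP q : shi_free q.
Proof. by elim: q => [|q ih]; [exact: shi_free0|exact: shi_freeS]. Qed.

Lemma fiber_free q n lo b z x (k : nat) e W A : (q <= n)%N ->
  (forall j, (j < n)%N -> lo j <= lo n) -> b - lo n + 1 = k%:Z ->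
  (forall W' A', indep n x z W' -> equations W' A' (shi_form q n lo b z x) ->
     free_with W' A' (e ++ nseq (\dim W' - n.+1) 0%N)) ->
  indep n.+1 x z W -> equations W A (shi_form q n.+1 lo b z x) ->
  free_with W A (e ++ (k + n)%N :: nseq (\dim W - n.+2) 0%N).
Proof.
move=> qn mlo ek F ind eA; have dW := indep_dim ind.
pose u (c : nat + int) : 'Hom(V, R^o) :=
  match c with inl j => x j | inr s => s%:~R *: z end.
pose valid (c : nat + int) : bool :=
  match c with inl j => (j < n)%N | inr s => lo n <= s <= b end.
pose P (us : seq (nat + int)) f := shi_form q n lo b z x f \/ exists2 c, c \in us & f = x n - u c.
have ind_n W' : indep n.+1 x z W' -> indep n x z W'.
  move=> ind' v c; have [w [wW zw xw]] := ind' v c.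
  by exists w; split=> // i i_n; apply: xw; apply: ltnW.
suff H (us : seq (nat + int)) A' : uniq us -> all valid us -> equations W A' (P us) ->
    free_with W A' (e ++ size us :: nseq (\dim W - n.+2) 0%N).
  have -> : (k + n)%N = size ([seq inl j | j <- iota 0 n] ++
      [seq inr (lo n + j%:Z) | j <- iota 0 k] : seq (nat + int)).
    by rewrite size_cat !size_map !size_iota addnC.
  apply: H.
  - have inl_inj : injective (fun j : nat => inl j : nat + int) by move=> i j [].
    have inr_inj : injective (fun j : nat => inr (lo n + j%:Z) : nat + int).
      by move=> i j [eij]; lia.
    rewrite cat_uniq (map_inj_uniq inl_inj) (map_inj_uniq inr_inj) !iota_uniq andbT.
    by apply/hasPn => c /mapP[j _ ->]; apply/negP => /mapP[].
  - rewrite all_cat; apply/andP; split; apply/allP => c /mapP[j]; rewrite mem_iota => hj -> /=.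
      lia.
    lia.
  - apply: equations_eq eA => f.
      case=> [|i j ij|i j ij|i s i_n hs]; first by exists z => //; left; apply: ShiZ.
      + have [jn|->] : (j < n)%N \/ j = n by lia.
          by exists (x i - x j) => //; left; apply: ShiD; lia.
        exists (x n - u (inl i)).
          right; exists (inl i) => //; rewrite mem_cat map_f //.
          by rewrite mem_iota; lia.
        by apply: eq_ker_opp => w _; rewrite !evalE opprB.
      + by exists (x i - x j - z) => //; left; apply: ShiS.
      + have [i_n'|ein] : (i < n)%N \/ i = n by lia.
          by exists (x i - s%:~R *: z) => //; left; apply: ShiP.
        exists (x n - u (inr s)); last by rewrite ein.
        right; exists (inr s) => //; rewrite mem_cat; apply/orP; right.
        apply/mapP; exists `|s - lo n|%N; first by rewrite mem_iota; move: hs; rewrite ein; lia.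
        by congr inr; move: hs; rewrite ein; lia.
    case=> [[|i j ij|i j ij|i s i_n hs]|[c]].
    + by exists z => //; apply: ShiZ.
    + by exists (x i - x j) => //; apply: ShiD; lia.
    + by exists (x i - x j - z) => //; apply: ShiS.
    + by exists (x i - s%:~R *: z) => //; apply: ShiP; rewrite // ltnW.
    rewrite mem_cat => /orP[] /mapP[j]; rewrite mem_iota => hj -> ->.
      exists (x j - x n); first by apply: ShiD; lia.
      by apply: eq_ker_opp => w _; rewrite !evalE opprB.
    by exists (x n - (lo n + j%:Z)%:~R *: z) => //; apply: ShiP; lia.
have key c c' : valid c -> valid c' -> c != c' ->
    forall W' f, (forall w, w \in W' -> f w = u c w - u c' w :> R) ->
    exists2 g, shi_form q n lo b z x g & eq_ker W' f g.
  move=> vc vc' cc' W' f sub.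
  case: c c' vc vc' cc' sub => [i|s] [j|t] /= vi vj ne sub.
  + have [ij|ij|ij] := ltngtP i j; last by rewrite ij eqxx in ne.
      exists (x i - x j); first by apply: ShiD; lia.
      by apply: eq_ker_same => w /sub ->; rewrite !evalE.
    exists (x j - x i); first by apply: ShiD; lia.
    by apply: eq_ker_opp => w /sub ->; rewrite !evalE opprB.
  + exists (x i - t%:~R *: z); last by apply: eq_ker_same => w /sub ->; rewrite !evalE.
    by apply: ShiP => //; have := mlo i vi; lia.
  + exists (x j - s%:~R *: z); last by apply: eq_ker_opp => w /sub ->; rewrite !evalE opprB.
    by apply: ShiP => //; have := mlo j vj; lia.
  + exists z; first exact: ShiZ.
    apply: (@eq_ker_scale _ _ _ _ _ (s - t)%:~R).
      by rewrite intr_eq0 subr_eq0; apply: contraNneq ne => ->.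
    by move=> w /sub ->; rewrite !evalE; ring.
elim: us A' => [|c us ih] A' /=.
  move=> _ _ eA'; have := F W A' (ind_n _ ind); rewrite -(subnSK dW); apply.
  apply: equations_eq eA'; last by apply: refines_sub; left.
  by apply: refines_sub => f [|[]].
move=> /andP[cus uus] /andP[vc vus] eA'.
pose f0 := x n - u c.
have uw w0 w1 : z w0 = z w1 -> (forall i, (i < n)%N -> x i w0 = x i w1) -> u c w0 = u c w1.
  by case: (c) vc => /= [j jn _ ->|s _ ez _]; rewrite ?evalE ?ez.
have indH : indep n x z (hyp W f0).
  move=> v c0; have [w0 [_ zw0 xw0]] := ind v c0.
  have [w [wW zw xw]] := ind (fun i => if i == n then u c w0 else v i) c0.
  exists w; split=> // [|i i_n]; last by rewrite xw ?(ltn_eqF i_n) // ltnW.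
  rewrite mem_hyp wW andbT !evalE xw // eqxx (uw w w0) ?subrr ?zw ?zw0 //.
  by move=> i i_n; rewrite xw ?xw0 ?(ltn_eqF i_n) // ltnW.
have nz0 : nz_on W f0.
  have [w0 [_ zw0 xw0]] := ind (fun=> 0) 0.
  have [w [wW zw xw]] := ind (fun i => if i == n then u c w0 + 1 else 0) 0.
  exists w; rewrite // !evalE xw // eqxx (uw w w0) ?zw ?zw0 //.
    by rewrite addrAC subrr add0r oner_eq0.
  by move=> i i_n; rewrite xw ?xw0 ?(ltn_eqF i_n) // ltnW.
have dH := dim_hyp nz0.
have hv w : w \in hyp W f0 -> x n w = u c w :> R.
  by rewrite mem_hyp !evalE subr_eq0 => /andP[/eqP].
apply: (@addition_equations _ _ W A' _ (P us) (shi_form q n lo b z x) f0 _ _ (size us) _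
   eA' nz0 _ _ _ _ (fun A' => ih A' uus vus) (fun A' => F _ A' indH)).
- move=> f; split=> [[Pf|[c']]|[[Pf|[c' c'us ->]]|->]].
  + by left; left.
  + rewrite in_cons => /orP[/eqP -> ->|c'us ->]; first by right.
    by left; right; exists c'.
  + by left.
  + by right; exists c'; rewrite // in_cons c'us orbT.
  + by right; exists c; rewrite // mem_head.
- by move=> g; apply: indep_form_nz indH _.
- move=> f [Pf|[c' c'us ->]]; first by exists f.
  have cc' : c != c' by apply: contraNneq cus => ->.
  have vc' : valid c' by apply: (allP vus).
  have sub w : w \in hyp W f0 -> (x n - u c') w = u c w - u c' w.
    by move=> /hv e'; rewrite !evalE e'.
  exact: key vc vc' cc' _ _ sub.
- by apply: refines_sub => f Pf; left.
- by rewrite -dH subSS; perm_count.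
- by rewrite -dH subSS; perm_count.
Qed.

Lemma flagged_shi q N p a W A x z : (0 < N)%N -> (p <= q)%N ->
  \dim W = q.+1 -> indep q x z W ->
  equations W A (shi_form q q (shi_lo a p) (a + N%:Z) z x) ->
  flagged W A (1%N :: nseq p (q + N).-1 ++ nseq (q - p) (q + N)%N).
Proof.
elim: q N p W A x => [|q ih] N p W A x N0 pq dW ind eA.
  have := shi_freeP N0 pq ind eA; rewrite dW subnn cats0 => F.
  have p0 : p = 0%N by lia.
  by rewrite p0 in F *; apply: flagged_line F.
have := shi_freeP N0 pq ind eA; rewrite dW subnn cats0 => F.
have nz0 := shift_nz (a + N%:Z) (ltnSn q) ind.
have dH := dim_hyp nz0; rewrite dW in dH; case: dH => dH.
have ind' := indep_hyp (a + N%:Z) (ltnSn q) ind.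
have xE i : (i < q)%N -> skip x q i = x i by apply: skip_lt.
have HA : hyp W (x q - (a + N%:Z)%:~R *: z) \in A.
  apply/eA; exists (x q - (a + N%:Z)%:~R *: z) => //.
  by apply: ShiP; rewrite // /shi_lo; lia.
have [arrA _ _ _] := F; have hv := @hyp_value _ _ W z x q (a + N%:Z).
have [m em] : {m | m = minn p q} by exists (minn p q).
apply: (flagged_step nz0 HA _ F (e' := 1%N :: nseq m (q + N.+1).-1 ++
    nseq (q - m) (q + N.+1)%N)).
- by rewrite dW /= size_cat !size_nseq; lia.
- rewrite dH /= take_cat size_nseq !addnS addSn /=; case: ltnP => pq'.
    have -> : m = q by lia.
    by rewrite take_nseq ?subnn ?cats0 // ltnW.
  have -> : m = p by lia.
  by rewrite take_nseq // leq_sub2r.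
apply: (ih N.+1 m _ _ _ _ _ _ ind') => //; first by lia.
apply: (equations_restr arrA eA nz0) => //.
- move=> f; case=> [|i j ij|i j ij|i s i_q hs].
  + by right; exists z => //; apply: ShiZ.
  + right; have [jq|->] : (j < q)%N \/ j = q by lia.
      by exists (x i - x j) => //; rewrite -!xE; [apply: ShiD; lia|lia|lia].
    exists (x i - (a + N%:Z)%:~R *: z).
      by rewrite -xE; [apply: ShiP; rewrite /shi_lo; lia|lia].
    by apply: eq_ker_same => w /hv; rewrite !evalE => ->.
  + right; have [jq|->] : (j < q)%N \/ j = q by lia.
      by exists (x i - x j - z) => //; rewrite -!xE; [apply: ShiS; lia|lia|lia].
    exists (x i - (a + N.+1%:Z)%:~R *: z).
      by rewrite -xE; [apply: ShiP; rewrite /shi_lo; lia|lia].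
    apply: eq_ker_same => w /hv; rewrite !evalE => ->.
    have -> : a + N.+1%:Z = a + N%:Z + 1 by lia.
    by ring.
  + have [iq|ei] : (i < q)%N \/ i = q by lia.
      right; exists (x i - s%:~R *: z) => //; rewrite -xE //.
      by apply: ShiP; move: hs; rewrite /shi_lo; lia.
    have [es|ns] := eqVneq s (a + N%:Z).
      by left=> w /hv; rewrite ei es !evalE => ->; rewrite subrr.
    right; exists z; first exact: ShiZ.
    by rewrite ei; apply: eq_ker_hom ns hv.
- move=> f; case=> [|i j ij|i j ij|i s i_q hs].
  + by exists z => //; apply: ShiZ.
  + by rewrite !xE; try lia; exists (x i - x j) => //; apply: ShiD; lia.
  + by rewrite !xE; try lia; exists (x i - x j - z) => //; apply: ShiS; lia.
  + rewrite xE //; have [es|ns] := eqVneq s (a + N.+1%:Z).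
      exists (x i - x q - z); first by apply: ShiS; lia.
      apply: eq_ker_same => w /hv; rewrite es !evalE => ->.
      have -> : a + N.+1%:Z = a + N%:Z + 1 by lia.
      by ring.
    exists (x i - s%:~R *: z) => //.
    by apply: ShiP; move: hs ns; rewrite /shi_lo; lia.
- by move=> g; apply: indep_form_nz ind' _.
Qed.

End ShiFree.

(** * The cone *)

Section ShiFibers.
Variables (R : realType) (V : vectType R).
Implicit Types (W H K X : {vspace V}) (A : {fset {vspace V}}).
Implicit Types (f g z : 'Hom(V, R^o)) (x : nat -> 'Hom(V, R^o)).

Variables (q N p : nat) (a : int) (lo : nat -> int) (k : nat -> nat).
Hypotheses (N0 : (0 < N)%N) (pq : (p <= q)%N).
Local Notation b := (a + N%:Z).
Hypothesis lo_shi : forall i, (i < q)%N -> lo i = shi_lo a p i.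
Hypothesis lo_mono : forall i j, (q <= i)%N -> (j < i)%N -> lo j <= lo i.
Hypothesis kE : forall i, (q <= i)%N -> b - lo i + 1 = (k i)%:Z.

Definition fiber_exp n : seq nat :=
  1%N :: nseq p (q + N).-1 ++ nseq (q - p) (q + N)%N ++
  [seq (k i + i)%N | i <- iota q (n - q)].

Lemma fiber_expS n : (q <= n)%N -> fiber_exp n.+1 = fiber_exp n ++ [:: (k n + n)%N].
Proof.
by move=> qn; rewrite /fiber_exp subSn // -[(n - q).+1]addn1 iotaD map_cat subnKC //= -!catA.
Qed.

Lemma size_fiber_exp n : (q <= n)%N -> size (fiber_exp n) = n.+1.
Proof. by move=> qn; rewrite /= !size_cat !size_nseq size_map size_iota; lia. Qed.

Lemma fibers_free n W A x z : (q <= n)%N -> indep n x z W ->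
  equations W A (shi_form q n lo b z x) ->
  free_with W A (fiber_exp n ++ nseq (\dim W - n.+1) 0%N).
Proof.
move=> qn; rewrite -(subnK qn); elim: (n - q)%N W A => [|r ih] W A ind eA.
  have {}eA := equations_shi_ext lo_shi eA.
  have := shi_freeP N0 pq ind eA.
  by rewrite /fiber_exp subnn /= cats0 -catA.
rewrite addSn fiber_expS ?leq_addl // -catA.
apply: (@fiber_free _ _ q (r + q) lo b z x) => //; first exact: leq_addl.
- by move=> j; apply: lo_mono; apply: leq_addl.
- by rewrite kE ?leq_addl.
Qed.

Lemma fibers_flagged n W A x z : (q <= n)%N ->
  (forall i, (q <= i < n)%N -> lo i <= b) ->
  \dim W = n.+1 -> indep n x z W -> equations W A (shi_form q n lo b z x) ->
  flagged W A (fiber_exp n).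
Proof.
move=> qn; rewrite -(subnK qn); elim: (n - q)%N W A => [|r ih] W A lob dW ind eA.
  have {}eA := equations_shi_ext lo_shi eA.
  have := flagged_shi N0 pq dW ind eA.
  by rewrite /fiber_exp subnn /= cats0.
set n' := (r + q)%N in ih *; rewrite -/n' addSn -/n' in lob dW ind eA *.
have qn' : (q <= n')%N by apply: leq_addl.
have F := fibers_free (leqW qn') ind eA; rewrite dW subnn cats0 in F.
have nz0 := shift_nz b (ltnSn n') ind.
have dH := dim_hyp nz0; rewrite dW in dH; case: dH => dH.
have ind' : indep n' x z (hyp W (x n' - b%:~R *: z)).
  move=> v c; have [w [wW zw xw]] := indep_hyp b (ltnSn n') ind v c.
  by exists w; split=> // i i_n; rewrite -xw // skip_lt.
have lo_b i : (i < n'.+1)%N -> lo i <= b.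
  move=> i_n; have [iq|qi] := ltnP i q; last by apply: lob; rewrite qi.
  by rewrite lo_shi // /shi_lo; lia.
have HA : hyp W (x n' - b%:~R *: z) \in A.
  by apply/eA; exists (x n' - b%:~R *: z) => //; apply: ShiP; rewrite // lo_b /=.
have [arrA _ _ _] := F; have hv := @hyp_value _ _ W z x n' b.
apply: (flagged_step nz0 HA _ F (e' := fiber_exp n')).
- by rewrite dW size_fiber_exp // leqW.
- by rewrite dH fiber_expS // take_size_cat // size_fiber_exp.
apply: (ih _ _ _ _ ind') => //; first by move=> i /andP[qi i_n]; apply: lob; rewrite qi ltnW.
apply: (equations_restr arrA eA nz0) => //.
- move=> f; case=> [|i j ij|i j ij|i s i_q hs].
  + by right; exists z => //; apply: ShiZ.
  + right; have [jq|->] : (j < n')%N \/ j = n' by lia.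
      by exists (x i - x j) => //; apply: ShiD; lia.
    exists (x i - b%:~R *: z).
      by apply: ShiP; [lia|rewrite lo_b ?lexx //; lia].
    by apply: eq_ker_same => w /hv; rewrite !evalE => ->.
  + by right; exists (x i - x j - z) => //; apply: ShiS; lia.
  + have [iq|ei] : (i < n')%N \/ i = n' by lia.
      by right; exists (x i - s%:~R *: z) => //; apply: ShiP.
    have [es|ns] := eqVneq s b.
      by left=> w /hv; rewrite ei es !evalE => ->; rewrite subrr.
    right; exists z; first exact: ShiZ.
    by rewrite ei; apply: eq_ker_hom ns hv.
- apply: refines_sub => f; case=> [|i j ij|i j ij|i s i_q hs].
  + exact: ShiZ.
  + by apply: ShiD; lia.
  + exact: ShiS.
  + by apply: ShiP; rewrite // ltnW.
- by move=> g; apply: indep_form_nz ind' _.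
Qed.

End ShiFibers.

Section Cone.
Variables (R : realType) (l : nat).
Implicit Types (w : 'rV[R]_(l + 1)).

Definition entry n (j : 'I_n) (v : 'rV[R]_n) : R^o := v 0 j.

Fact entry_is_linear n (j : 'I_n) : linear (entry j).
Proof. by move=> c u v; rewrite /entry !mxE. Qed.

HB.instance Definition _ n (j : 'I_n) :=
  GRing.isLinear.Build R 'rV[R]_n R^o _ (entry j) (@entry_is_linear n j).

Definition zform : 'Hom('rV[R]_(l + 1), R^o) := linfun (entry (rshift l 0)).

(* Junk value 0 beyond the l coordinates of R^l. *)
Definition xform (i : nat) : 'Hom('rV[R]_(l + 1), R^o) :=
  if insub i is Some j then linfun (entry (lshift 1 (j : 'I_l))) else 0.

Lemma zformE w : zform w = rsubmx w 0 0.
Proof. by rewrite lfunE /= /entry mxE. Qed.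

Lemma xformE (i : 'I_l) w : xform i w = lsubmx w 0 i.
Proof. by rewrite /xform valK lfunE /= /entry mxE. Qed.

Lemma indep_cone : indep l xform zform fullv.
Proof.
move=> v c; exists (row_mx (\row_i v (val i)) c%:M); split; first exact: memvf.
  by rewrite zformE row_mxKr mxE eqxx.
by move=> i i_l; rewrite -[i]/(val (Ordinal i_l)) xformE row_mxKl mxE.
Qed.

Lemma mem_cone_form (a : 'cV[R]_l) (c : R) w :
  (w \in lin_hyp (col_mx a (- c)%:M)) = ((lsubmx w *m a) 0 0 == c * zform w).
Proof.
rewrite -{1}[w]hsubmxK mem_cone_hyp zformE.
have -> : c * rsubmx w 0 0 = (c *: rsubmx w) 0 0 by rewrite [RHS]mxE.
apply/eqP/eqP => [-> //|e]; apply/matrixP => i j.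
by rewrite !ord1.
Qed.

Lemma lin_hyp_form (u : 'cV[R]_(l + 1)) (f : 'Hom('rV[R]_(l + 1), R^o)) :
  (forall w, (w \in lin_hyp u) = (f w == 0)) -> lin_hyp u = hyp fullv f.
Proof. by move=> e; apply/vspaceP => w; rewrite e mem_hyp memvf andbT. Qed.

Lemma mul_coord_form (v : 'rV[R]_l) i : (v *m coord_form R i) 0 0 = v 0 i.
Proof. by rewrite /coord_form -colE mxE. Qed.

Lemma cone_diff (i j : 'I_l) (c : R) :
  lin_hyp (col_mx (coord_form R i - coord_form R j) (- c)%:M) =
  hyp fullv (xform i - xform j - c *: zform).
Proof.
apply: lin_hyp_form => w; rewrite mem_cone_form mulmxBr.
have -> (M M' : 'M[R]_1) : (M - M') 0 0 = M 0 0 - M' 0 0 by rewrite !mxE.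
rewrite !mul_coord_form.
by rewrite !evalE !xformE subr_eq0.
Qed.

Lemma cone_shift (i : 'I_l) (c : R) :
  lin_hyp (col_mx (coord_form R i) (- c)%:M) = hyp fullv (xform i - c *: zform).
Proof.
apply: lin_hyp_form => w; rewrite mem_cone_form mul_coord_form.
by rewrite !evalE !xformE subr_eq0.
Qed.

Lemma cone_infty : lin_hyp (col_mx 0 1%:M) = hyp fullv zform.
Proof.
apply: lin_hyp_form => w.
have -> : (1 : R) = - (-1) by rewrite opprK.
rewrite mem_cone_form mulmx0 mxE mulN1r eq_sym oppr_eq0.
by [].
Qed.

Variables (m d p k : nat).
Hypotheses (hk1 : (1 <= k)%N) (hkl : (k <= l)%N) (hpl : (p <= l)%N).

Definition lo_Apk (i : nat) : int :=
  - (minn (l - i) k)%:Z - m%:Z + (i < p)%N.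

Lemma cone_equations :
  equations fullv (cone (arr_Apk R l m d p k))
    (shi_form (l + 1 - k) l lo_Apk d%:Z zform xform).
Proof.
move=> K; split.
  rewrite in_fsetU => /orP[/imfsetP[[a c] /= + ->]|]; last first.
    by rewrite in_fset1 => /eqP ->; rewrite cone_infty; exists zform => //; apply: ShiZ.
  rewrite !mem_cat => /or4P[] /allpairsPdep[i [j []]] => [iE|iE|iE|iE];
    rewrite ?mem_filter ?mem_enum ?mem_zrange => jE [-> ->].
  - rewrite cone_diff scale0r subr0; exists (xform i - xform j) => //.
    by apply: ShiD; case/andP: jE => -> _; rewrite ltn_ord.
  - rewrite cone_diff scale1r; exists (xform i - xform j - zform) => //.
    by apply: ShiS; case/andP: jE => jE _; lia.
  - rewrite cone_shift; exists (xform i - j%:~R *: zform) => //.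
    move: iE; rewrite mem_filter => /andP[ip _].
    by apply: ShiP => //; have := ltn_ord i; rewrite /lo_Apk; lia.
  - rewrite cone_shift; exists (xform i - j%:~R *: zform) => //.
    move: iE; rewrite mem_filter => /andP[ip _].
    by apply: ShiP => //; have := ltn_ord i; rewrite /lo_Apk; lia.
case=> f Pf ->; rewrite in_fsetU; apply/orP; case: Pf => [|i j ij|i j ij|i s i_l hs].
- by right; rewrite in_fset1 cone_infty.
- left; have [il jl] : (i < l)%N /\ (j < l)%N by lia.
  apply/imfsetP; exists (coord_form R (Ordinal il) - coord_form R (Ordinal jl), 0) => /=.
    rewrite !mem_cat; apply/orP; left; apply/allpairsPdep.
    exists (Ordinal il), (Ordinal jl); (split=> //; first by rewrite mem_enum).
    by rewrite mem_filter mem_enum; apply/andP; split=> //=; lia.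
  by rewrite cone_diff scale0r subr0.
- left; have [il jl] : (i < l)%N /\ (j < l)%N by lia.
  apply/imfsetP; exists (coord_form R (Ordinal il) - coord_form R (Ordinal jl), 1) => /=.
    rewrite !mem_cat; apply/orP; right; apply/orP; left; apply/allpairsPdep.
    exists (Ordinal il), (Ordinal jl); (split=> //; first by rewrite mem_enum).
    by rewrite mem_filter mem_enum; apply/andP; split=> //=; lia.
  by rewrite cone_diff scale1r.
- left; apply/imfsetP; exists (coord_form R (Ordinal i_l), s%:~R) => /=; last by rewrite cone_shift.
  rewrite !mem_cat; apply/orP; right; apply/orP; right; apply/orP.
  have [ip|pi] := ltnP i p; [left|right]; apply/allpairsPdep;
    exists (Ordinal i_l), s; (split=> //;
      [by rewrite mem_filter mem_enum; apply/andP; split=> //=; lia|]);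
    by rewrite mem_zrange /=; move: hs; rewrite /lo_Apk; lia.
Qed.

End Cone.

Lemma nseq_step p n (L M : nat) : (p <= n)%N ->
  nseq p L ++ nseq (n - p) M = [seq if (i < p)%N then L else M | i <- iota 0 n].
Proof.
move=> pn; apply: (@eq_from_nth _ 0%N).
  by rewrite size_cat !size_nseq size_map size_iota subnKC.
move=> i; rewrite size_cat !size_nseq subnKC // => i_n.
rewrite (nth_map 0%N) ?size_iota // nth_iota // add0n nth_cat size_nseq !nth_nseq.
by case: ltnP => // pi; rewrite ltn_sub2r // (leq_ltn_trans pi).
Qed.

Theorem theorem7p20 (R : realType) (l m d p k : nat)
    (hk1 : (1 <= k)%N) (hkl : (k <= l)%N) (hpl : (p <= l)%N) :
  ind_flag_accurate fullv (cone (arr_Apk R l m d p k)) /\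
  has_exponents fullv (cone (arr_Apk R l m d p k))
    (1%N :: nseq p (l + m + d)%N ++ nseq (l - p) (l + m + d + 1)%N).
Proof.
pose q := (l + 1 - k)%N; pose N := (k + m + d)%N.
pose a : int := - k%:Z - m%:Z; pose lo := lo_Apk l m p k.
pose e i := (l - i + m + d + 1 - (i < p))%N.
have [p' ep'] : {p' | p' = minn p q} by exists (minn p q).
have N0 : (0 < N)%N by lia.
have p'q : (p' <= q)%N by lia.
have eb : d%:Z = a + N%:Z by lia.
have ql : (q <= l)%N by lia.
have lo_shi i : (i < q)%N -> lo i = shi_lo a p' i by rewrite /lo /lo_Apk /shi_lo; lia.
have dimV : \dim (fullv : {vspace 'rV[R]_(l + 1)}) = l.+1.
  by rewrite dimvf /dim /= mul1n addn1.
have eE : fiber_exp q N p' e l =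
    1%N :: nseq p (l + m + d)%N ++ nseq (l - p) (l + m + d + 1)%N.
  congr (_ :: _); rewrite catA !nseq_step //.
  rewrite -[in RHS](subnKC ql) iotaD map_cat; congr (_ ++ _).
    by apply/eq_in_map => i; rewrite mem_iota => iq; case: ltnP => ?; case: ltnP => ?; lia.
  by apply/eq_in_map => i; rewrite mem_iota /e => iq; case: ltnP => ?; lia.
have lo_mono i j : (q <= i)%N -> (j < i)%N -> lo j <= lo i.
  by rewrite /lo /lo_Apk => qi ji; lia.
have kE i : (q <= i)%N -> a + N%:Z - lo i + 1 = (e i)%:Z.
  by rewrite /lo /lo_Apk /e => qi; lia.
have eA := @cone_equations R l m d p k hk1 hkl hpl; rewrite eb -/q -/lo in eA.
have ind := @indep_cone R l.
have F := fibers_free N0 p'q lo_shi lo_mono kE ql ind eA.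
rewrite dimV subnn cats0 eE in F; have [arrA he iA _] := F.
split=> //; exists (fiber_exp q N p' e l); rewrite eE; split=> //.
  rewrite nseq_step //= path_min_sorted; last by apply/allP => j /mapP[i _ ->]; case: ifP; lia.
  apply: (homo_sorted _ _ (iota_sorted 0 l)) => i j ij.
  by case: ltnP => ?; case: ltnP => ?; lia.
have := fibers_flagged N0 p'q lo_shi lo_mono kE ql _ dimV ind eA; rewrite eE; apply.
by move=> i qi; rewrite /lo /lo_Apk; lia.
Qed.
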